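(* Let $\Gamma$ be either $\mathrm{O}_2\mathbb{R}$ or $\mathrm{SO}_2\mathbb{R}$. A compact spread $\mathcal{C}$ of $\mathrm{PG}(3,\mathbb{R})$ is a $\Gamma$-rotational spread if and only if it is invariant under an action of the group $\Gamma$ on $\mathrm{PG}(3,\mathbb{R})$ (by collineations) that is equivalent to the projective extension of the standard action of $\Gamma\le\mathrm{SO}_3\mathbb{R}$ on $\mathbb{R}^3$.
   Context: The space of lines of $\mathrm{PG}(3,\mathbb{R})$ is topologized as a coset space of $\mathrm{PGL}(4,\mathbb{R})$. A compact spread is a compact set of pairwise disjoint lines covering the point set of $\mathrm{PG}(3,\mathbb{R})$. Two spreads are isomorphic if some collineation of $\mathrm{PG}(3,\mathbb{R})$ (element of $\mathrm{PGL}_4\mathbb{R}$) maps one onto the other. View $\mathbb{R}^3$ as the affine complement of a plane $F$ of $\mathrm{PG}(3,\mathbb{R})$; affine maps of $\mathbb{R}^3$ extend to collineations of $\mathrm{PG}(3,\mathbb{R})$ (projective extension). The standard $\mathrm{SO}_2\mathbb{R}\le\mathrm{SO}_3\mathbb{R}$ is the group of rotations about the $z$-axis; the standard $\mathrm{O}_2\mathbb{R}\le\mathrm{SO}_3\mathbb{R}$ is the group generated by these rotations and a half-turn about a line through the origin perpendicular to the $z$-axis. Equivalence of actions means conjugacy in $\mathrm{PGL}_4\mathbb{R}$. Rotational spreads. Let $Z$ be the (projective closure of the) $z$-axis and $V$ the line at infinity of the $xy$-plane. For functions $a:(0,\infty)\to(0,\infty)$, $b:(0,\infty)\to\mathbb{R}$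 and $r>0$ let $\mathcal{R}_r$ be the right-screwed regulus carried by the hyperboloid $x^2+y^2-(z-b(r))^2/a(r)^2=r^2$, i.e. the set of all images of the line $\{(r,t,b(r)+a(r)t) \mid t\in\mathbb{R}\}$ under rotations about the $z$-axis. A compact spread is $\mathrm{SO}_2\mathbb{R}$-rotational if it is isomorphic to a compact spread of the form $\{Z,V\}\cup\bigcup_{r>0}\mathcal{R}_r$ for some $a,b$; it is $\mathrm{O}_2\mathbb{R}$-rotational if this is possible with $b$ constant. *)

(* Defs.v *)
From HB Require Import structures.
From mathcomp Require Import all_boot all_order all_algebra.

From mathcomp Require Import ring lra.
From mathcomp Require Import all_classical all_reals all_analysis.

Set Implicit Arguments.
Unset Strict Implicit.
Unset Printing Implicit Defensive.

Import Order.TTheory GRing.Theory Num.Theory.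
Import numFieldNormedType.Exports.

Local Open Scope classical_set_scope.
Local Open Scope ring_scope.

Section GeneralLinearGroup.
Variables (R : realType) (n : nat).

Definition GL : Type := {g : 'M[R]_n | g \in unitmx}.

HB.instance Definition _ := SubType.on GL.
HB.instance Definition _ := Choice.on GL.
HB.instance Definition _ :=
  Topological.copy GL (initial_topology (val : GL -> 'M[R]_n)).

Definition GL_one : GL := Sub 1%:M (unitmx1 R n).

Fact GL_mul_subproof (g h : GL) : val g *m val h \in unitmx.
Proof. by rewrite unitmx_mul (valP g) (valP h). Qed.
Definition GL_mul (g h : GL) : GL := Sub (val g *m val h) (GL_mul_subproof g h).

Fact GL_inv_subproof (g : GL) : invmx (val g) \in unitmx.
Proof. by rewrite unitmx_inv (valP g). Qed.
Definition GL_inv (g : GL) : GL := Sub (invmx (val g)) (GL_inv_subproof g).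

Fact GL_mulA : associative GL_mul.
Proof. by move=> g h k; apply: val_inj; rewrite /= mulmxA. Qed.
Fact GL_mul1g : left_id GL_one GL_mul.
Proof. by move=> g; apply: val_inj; rewrite /= mul1mx. Qed.
Fact GL_mulg1 : right_id GL_one GL_mul.
Proof. by move=> g; apply: val_inj; rewrite /= mulmx1. Qed.
Fact GL_mulVg : left_inverse GL_one GL_inv GL_mul.
Proof. by move=> g; apply: val_inj; rewrite /= mulVmx ?(valP g). Qed.
Fact GL_mulgV : right_inverse GL_one GL_inv GL_mul.
Proof. by move=> g; apply: val_inj; rewrite /= mulmxV ?(valP g). Qed.

HB.instance Definition _ :=
  isGroup.Build GL GL_mulA GL_mul1g GL_mulg1 GL_mulVg GL_mulgV.

Lemma GL_valM (g h : GL) : val (g * h)%g = val g *m val h.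
Proof. by []. Qed.

Lemma GL_valV (g : GL) : val (g^-1)%g = invmx (val g).
Proof. by []. Qed.

(* PGL is GL modulo nonzero scalars, with the quotient topology. *)
Definition proportional (g h : GL) : bool :=
  `[< exists2 c : R, c != 0 & val g = c *: val h >].

Fact proportional_refl : reflexive proportional.
Proof. by move=> g; apply/asboolP; exists 1; rewrite ?oner_neq0 ?scale1r. Qed.
Fact proportional_sym : symmetric proportional.
Proof.
suff H g h : proportional g h -> proportional h g by move=> g h; apply/idP/idP; exact: H.
move=> /asboolP[c c0 E]; apply/asboolP; exists c^-1; first by rewrite invr_eq0.
by rewrite E scalerA mulVf ?scale1r.
Qed.
Fact proportional_trans : transitive proportional.
Proof.
move=> h g k /asboolP[c c0 E] /asboolP[d d0 E']; apply/asboolP.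
by exists (c * d); rewrite ?mulf_neq0 // E E' scalerA.
Qed.

Canonical proportional_equiv :=
  EquivRel proportional proportional_refl proportional_sym proportional_trans.

Definition PGL : Type := quotient_topology {eq_quot proportional}%qT.

HB.instance Definition _ := Topological.on PGL.
HB.instance Definition _ := Quotient.on PGL.

Definition toPGL (g : GL) : PGL := \pi_PGL%qT g.

Lemma toPGL_eq (g h : GL) :
  toPGL g = toPGL h <-> exists2 c : R, c != 0 & val g = c *: val h.
Proof.
split=> [/eqquotP/asboolP//|E]; apply/eqquotP; exact/asboolP.
Qed.

Lemma repr_PGL (p : PGL) : toPGL (repr p) = p.
Proof. exact: reprK. Qed.

Definition PGL_one : PGL := toPGL 1%g.
Definition PGL_mul (p q : PGL) : PGL := toPGL (repr p * repr q)%g.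
Definition PGL_inv (p : PGL) : PGL := toPGL (repr p)^-1%g.

Lemma toPGL_mul (g h : GL) : PGL_mul (toPGL g) (toPGL h) = toPGL (g * h)%g.
Proof.
have /toPGL_eq[c c0 Ec] := repr_PGL (toPGL g).
have /toPGL_eq[d d0 Ed] := repr_PGL (toPGL h).
apply/toPGL_eq; exists (c * d); rewrite ?mulf_neq0 //.
by rewrite !GL_valM Ec Ed -scalemxAl -scalemxAr scalerA.
Qed.

Lemma toPGL_inv (g : GL) : PGL_inv (toPGL g) = toPGL (g^-1)%g.
Proof.
have /toPGL_eq[c c0 Ec] := repr_PGL (toPGL g).
apply/toPGL_eq; exists c^-1; rewrite ?invr_eq0 //.
by rewrite !GL_valV Ec invmxZ // -Ec; exact: (valP (repr (toPGL g))).
Qed.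

Fact PGL_mulA : associative PGL_mul.
Proof.
move=> p q r; rewrite -(repr_PGL p) -(repr_PGL q) -(repr_PGL r).
by rewrite !toPGL_mul mulgA.
Qed.
Fact PGL_mul1g : left_id PGL_one PGL_mul.
Proof. by move=> p; rewrite -(repr_PGL p) toPGL_mul mul1g. Qed.
Fact PGL_mulg1 : right_id PGL_one PGL_mul.
Proof. by move=> p; rewrite -(repr_PGL p) toPGL_mul mulg1. Qed.
Fact PGL_mulVg : left_inverse PGL_one PGL_inv PGL_mul.
Proof. by move=> p; rewrite -(repr_PGL p) toPGL_inv toPGL_mul mulVg. Qed.
Fact PGL_mulgV : right_inverse PGL_one PGL_inv PGL_mul.
Proof. by move=> p; rewrite -(repr_PGL p) toPGL_inv toPGL_mul mulgV. Qed.

HB.instance Definition _ :=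
  isGroup.Build PGL PGL_mulA PGL_mul1g PGL_mulg1 PGL_mulVg PGL_mulgV.

End GeneralLinearGroup.

Section ProjectiveSpace.
Variable R : realType.

Definition pspace (k : nat) : Type := {U : {vspace 'cV[R]_4} | \dim U == k}.
HB.instance Definition _ k := SubType.on (pspace k).
HB.instance Definition _ k := Choice.on (pspace k).

Definition proj_point : Type := pspace 1.
Definition line : Type := pspace 2.
HB.instance Definition _ := SubType.on proj_point.
HB.instance Definition _ := Choice.on proj_point.
HB.instance Definition _ := SubType.on line.
HB.instance Definition _ := Choice.on line.

Definition incident (p : proj_point) (L : line) : Prop := (val p <= val L)%VS.

Fact GL_line_subproof (g : GL R 4) (L : line) :
  \dim (linfun (mulmx (val g) : 'cV[R]_4 -> 'cV[R]_4) @: val L)%VS == 2%N.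
Proof.
rewrite limg_dim_eq ?(eqP (valP L)) //.
suff -> : lker (linfun (mulmx (val g) : 'cV[R]_4 -> 'cV[R]_4)) = 0%VS by rewrite capv0.
apply/eqP/lker0P => u v; rewrite !lfunE /= => E.
by rewrite -[u](mulKmx (valP g)) E mulKmx ?(valP g).
Qed.

Definition GL_line (g : GL R 4) (L : line) : line :=
  Sub (linfun (mulmx (val g) : 'cV[R]_4 -> 'cV[R]_4) @: val L)%VS
      (GL_line_subproof g L).

Definition collineate (p : PGL R 4) (L : line) : line := GL_line (repr p) L.

Lemma collineate_toPGL (g : GL R 4) (L : line) :
  collineate (toPGL g) L = GL_line g L.
Proof.
have /toPGL_eq[c c0 Ec] := repr_PGL (toPGL g).
apply/val_inj/vspaceP => v; rewrite /= Ec.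
apply/memv_imgP/memv_imgP => -[u uL ->].
  by exists (c *: u); rewrite ?memvZ // !lfunE /= -scalemxAl scalemxAr.
exists (c^-1 *: u); rewrite ?memvZ // !lfunE /= -scalemxAl -scalemxAr scalerA.
by rewrite mulfV ?scale1r.
Qed.

Fact span_line_subproof (u v : 'cV[R]_4) (uv : free [:: u; v]) :
  \dim <<[:: u; v]>>%VS == 2%N.
Proof. exact: uv. Qed.

Definition span_line (u v : 'cV[R]_4) (uv : free [:: u; v]) : line :=
  Sub <<[:: u; v]>>%VS (span_line_subproof uv).

Definition vec3 (x y z : R) : 'cV[R]_3 := \col_i [:: x; y; z]`_i.

(* Homogeneous coordinates are columns (x, y, z, w); R^3 is the complement of
   the plane F of equation w = 0. *)
Definition affine_pt (p : 'cV[R]_3) : 'cV[R]_4 := col_mx p (1%:M : 'cV[R]_1).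
Definition infinite_pt (d : 'cV[R]_3) : 'cV[R]_4 := col_mx d (0 : 'cV[R]_1).

Lemma infinite_ptZ (k : R) (d : 'cV[R]_3) :
  infinite_pt (k *: d) = k *: infinite_pt d.
Proof.
rewrite /infinite_pt -[X in col_mx _ X](scaler0 _ k).
by rewrite -(scale_col_mx k d (0 : 'cV[R]_1)).
Qed.

Fact affine_line_free (p d : 'cV[R]_3) :
  d != 0 -> free [:: affine_pt p; infinite_pt d].
Proof.
move=> d0; rewrite free_cons; apply/andP; split; last first.
  rewrite seq1_free; apply: contraNneq d0 => E.
  by rewrite -(col_mxKu d (0 : 'cV[R]_1)) -/(infinite_pt d) E linear0.
rewrite span_seq1; apply/negP => /vlineP[k].
rewrite -infinite_ptZ => /(@eq_col_mx R 3 1 1 _ _ _ _)[_].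
by move=> /matrixP/(_ ord0 ord0); rewrite !mxE eqxx => /eqP; rewrite oner_eq0.
Qed.

(* The projective closure of {p + t d | t in R}. *)
Definition affine_line (p d : 'cV[R]_3) (d0 : d != 0) : line :=
  span_line (affine_line_free p d0).

Fact infinite_line_free (d e : 'cV[R]_3) :
  free [:: d; e] -> free [:: infinite_pt d; infinite_pt e].
Proof.
rewrite !(free_cons _ [:: _]) !span_seq1 !seq1_free.
have inf_inj : injective infinite_pt by move=> v w /(@eq_col_mx R 3 1 1 _ _ _ _)[].
have inf0 : infinite_pt 0 = 0 by rewrite /infinite_pt col_mx0.
move=> /andP[de e0]; apply/andP; split; last first.
  by apply: contra_neq e0 => E; apply: inf_inj; rewrite inf0.
apply: contraNN de => /vlineP[k]; rewrite -infinite_ptZ => /inf_inj ->.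
exact/vlineP/(ex_intro _ k).
Qed.

Definition infinite_line (d e : 'cV[R]_3) (de : free [:: d; e]) : line :=
  span_line (infinite_line_free de).

Fact ez_neq0 : vec3 0 0 1 != 0.
Proof.
apply/eqP => /matrixP/(_ (inord 2) ord0).
by rewrite !mxE inordK //= => /eqP; rewrite oner_eq0.
Qed.

Definition Zline : line := affine_line 0 ez_neq0.

Fact exy_free : free [:: vec3 1 0 0; vec3 0 1 0].
Proof.
rewrite free_cons span_seq1 seq1_free; apply/andP; split.
  apply/negP => /vlineP[k] /matrixP/(_ ord0 ord0).
  by rewrite !mxE /= mulr0 => /eqP; rewrite oner_eq0.
apply/eqP => /matrixP/(_ (inord 1) ord0).
by rewrite !mxE inordK //= => /eqP; rewrite oner_eq0.
Qed.

Definition Vline : line := infinite_line exy_free.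

(* PGL(4,R) acts transitively on lines, so p |-> p Zline identifies the coset
   space of the stabilizer of Zline with the set of lines; the topology below is
   the quotient topology of that coset space. *)
Definition line_open (U : set line) : Prop :=
  open ((fun p : PGL R 4 => collineate p Zline) @^-1` U).

Fact line_openT : line_open setT.
Proof. by rewrite /line_open preimage_setT; exact: openT. Qed.
Fact line_openI : setI_closed line_open.
Proof. by move=> U W oU oW; rewrite /line_open preimage_setI; exact: openI. Qed.
Fact line_open_bigU (I : Type) (f : I -> set line) :
  (forall i, line_open (f i)) -> line_open (\bigcup_i f i).
Proof.
by move=> of_; rewrite /line_open preimage_bigcup; apply: bigcup_open => i _; exact: of_.
Qed.

HB.instance Definition _ :=
  isOpenTopological.Build line line_openT line_openI line_open_bigU.

Definition spread (C : set line) : Prop :=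
  (forall L M, C L -> C M -> L <> M ->
     ~ exists p : proj_point, incident p L /\ incident p M) /\
  (forall p : proj_point, exists2 L, C L & incident p L).

Definition compact_spread (C : set line) : Prop := compact C /\ spread C.

Definition isomorphic (C D : set line) : Prop :=
  exists p : PGL R 4, collineate p @` C = D.

End ProjectiveSpace.

Section Rotations.
Variable R : realType.

Definition mx3 (u v w : 'cV[R]_3) : 'M[R]_3 :=
  \matrix_(i, j) ([:: u; v; w]`_j) i ord0.

Definition rotz_mx (t : R) : 'M[R]_3 :=
  mx3 (vec3 (cos t) (sin t) 0) (vec3 (- sin t) (cos t) 0) (vec3 0 0 1).

Definition halfturn_mx : 'M[R]_3 :=
  mx3 (vec3 1 0 0) (vec3 0 (-1) 0) (vec3 0 0 (-1)).

Fact rotz_unit (t : R) : rotz_mx t \in unitmx.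
Proof.
suff /mulmx1_unit[] : rotz_mx t *m rotz_mx (- t) = 1%:M by [].
have E := cos2Dsin2 t.
apply/matrixP => i j; rewrite !mxE !big_ord_recl big_ord0 !mxE /= cosN sinN.
case: i => -[|[|[|//]]] ?; case: j => -[|[|[|//]]] ?; rewrite /= ?mxE /=;
  by lra.
Qed.

Fact halfturn_unit : halfturn_mx \in unitmx.
Proof.
suff /mulmx1_unit[] : halfturn_mx *m halfturn_mx = 1%:M by [].
apply/matrixP => i j; rewrite !mxE !big_ord_recl big_ord0 !mxE /=.
by case: i => -[|[|[|//]]] ?; case: j => -[|[|[|//]]] ?; rewrite /= ?mxE /=; lra.
Qed.

Definition rotz (t : R) : GL R 3 := Sub (rotz_mx t) (rotz_unit t).
(* The half-turn about the x-axis; with the rotations it generates the same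
   group as the half-turn about any other line through 0 orthogonal to the
   z-axis. *)
Definition halfturn : GL R 3 := Sub halfturn_mx halfturn_unit.

Definition subgroup (G : groupType) (A : set G) : Prop :=
  A 1%g /\ forall x y, A x -> A y -> A (x * y^-1)%g.

Inductive rotation_group := O2 | SO2.

Definition standard_group (Gamma : rotation_group) : set (GL R 3) :=
  match Gamma with
  | SO2 => range rotz
  | O2 => smallest (@subgroup (GL R 3)) (range rotz `|` [set halfturn])
  end.

Fact proj_ext_unit (A : GL R 3) :
  (block_mx (val A) 0 0 1%:M : 'M[R]_(3 + 1)) \in unitmx.
Proof. by rewrite unitmxE det_ublock det1 mulr1 -unitmxE (valP A). Qed.

Definition proj_ext (A : GL R 3) : PGL R 4 :=
  toPGL (Sub (block_mx (val A) 0 0 1%:M : 'M[R]_(3 + 1)) (proj_ext_unit A) : GL R 4).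

Definition action_by_collineations (S : set (GL R 3)) (phi : GL R 3 -> PGL R 4) :=
  forall A B, S A -> S B -> phi (A * B)%g = (phi A * phi B)%g.

Definition equivalent_actions (S : set (GL R 3)) (phi psi : GL R 3 -> PGL R 4) :=
  exists p : PGL R 4, forall A, S A -> phi A = (p * psi A * p^-1)%g.

Definition action_invariant (S : set (GL R 3)) (phi : GL R 3 -> PGL R 4)
  (C : set (line R)) :=
  forall A, S A -> collineate (phi A) @` C = C.

Fact ruling_direction_neq0 (a : R) : vec3 0 1 a != 0.
Proof.
apply/eqP => /matrixP/(_ (inord 1) ord0).
by rewrite !mxE inordK //= => /eqP; rewrite oner_eq0.
Qed.

(* The closure of {(r, t, b + a t) | t in R}; for 0 < r, 0 < a it lies on
   x^2 + y^2 - (z - b)^2 / a^2 = r^2. *)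
Definition ruling (r a b : R) : line R :=
  affine_line (vec3 r 0 b) (ruling_direction_neq0 a).

Definition regulus (r a b : R) : set (line R) :=
  [set collineate (proj_ext (rotz t)) (ruling r a b) | t in [set: R]].

Definition rotational_form (a b : R -> R) : set (line R) :=
  [set Zline R; Vline R] `|` \bigcup_(r in [set r | 0 < r]) regulus r (a r) (b r).

(* a and b are functions on the positive reals: only the values there are
   constrained or used. *)
Definition rotational (Gamma : rotation_group) (C : set (line R)) : Prop :=
  exists a b : R -> R,
    [/\ forall r, 0 < r -> 0 < a r,
        (Gamma = O2 -> exists c, forall r, 0 < r -> b r = c),
        compact_spread (rotational_form a b) &
        isomorphic C (rotational_form a b)].

End Rotations.

Arguments standard_group R Gamma : clear implicits.

(* Main.v *)
Require Import Defs.
From mathcomp Require Import all_boot all_order all_algebra.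
From mathcomp Require Import ring lra.
From mathcomp Require Import all_classical all_reals all_analysis.

Set Implicit Arguments.
Unset Strict Implicit.
Unset Printing Implicit Defensive.

Import Order.TTheory GRing.Theory Num.Theory.
Import numFieldNormedType.Exports.

Local Open Scope classical_set_scope.
Local Open Scope ring_scope.

(* Up to conjugation, let the spread be invariant under the rotations about the
   z-axis. The lines through (0,0,0) and through the point at infinity of the
   x-axis are then forced to be Z and V. Any other line misses Z and V and, by
   its point nearest to Z, is a rotated ruling of a hyperboloid
   x^2 + y^2 = r^2 + ((z - b)/a)^2 with a <> 0. As functions of z, the right-hand
   sides are parabolas whose graphs partition the open upper half plane,
   and a nested interval argument shows that every r > 0 occurs as a waist
   radius; r determines (a, b) because otherwise two rulings would meet. Compactness
   makes the line through (r,0,0) depend continuously on r, so all the reguli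
   have the same handedness, which the reflection x |-> -x makes the required
   one. Invariance under the half-turn sends the ruling (r, a, b) to
   (r, a, -b), which forces b = 0. *)

(** * Homogeneous coordinates and lines *)

Section Coordinates.
Variable R : realType.
Implicit Types (x y z w s t r a b : R) (L M : line R) (g h : GL R 4).

Definition hvec x y z w : 'cV[R]_4 := \col_i [:: x; y; z; w]`_i.

Lemma col4P (u v : 'cV[R]_4) :
  [/\ u (inord 0) 0 = v (inord 0) 0, u (inord 1) 0 = v (inord 1) 0,
      u (inord 2) 0 = v (inord 2) 0 & u (inord 3) 0 = v (inord 3) 0] -> u = v.
Proof.
move=> [E0 E1 E2 E3]; apply/matrixP => i j; rewrite (ord1 j) -[i]inord_val.
by case: i => -[|[|[|[|//]]]].
Qed.

Lemma hvecP (v : 'cV[R]_4) : exists x y z w, v = hvec x y z w.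
Proof.
exists (v (inord 0) 0), (v (inord 1) 0), (v (inord 2) 0), (v (inord 3) 0).
by apply: col4P; rewrite !mxE !inordK.
Qed.

Lemma hvec_inj x y z w x' y' z' w' :
  hvec x y z w = hvec x' y' z' w' -> [/\ x = x', y = y', z = z' & w = w'].
Proof.
move=> /matrixP E; have := (E (inord 0) 0, E (inord 1) 0, E (inord 2) 0, E (inord 3) 0).
by rewrite !mxE !inordK //= => -[[[-> ->] ->] ->].
Qed.

Lemma hvecD x y z w x' y' z' w' :
  hvec x y z w + hvec x' y' z' w' = hvec (x + x') (y + y') (z + z') (w + w').
Proof. by apply: col4P; rewrite !mxE !inordK. Qed.

Lemma hvecZ s x y z w :
  s *: hvec x y z w = hvec (s * x) (s * y) (s * z) (s * w).
Proof. by apply: col4P; rewrite !mxE !inordK. Qed.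

Lemma hvec0 : hvec 0 0 0 0 = 0.
Proof. by apply: col4P; rewrite !mxE !inordK. Qed.

Lemma hvec_col_mx x y z w : hvec x y z w = col_mx (vec3 x y z) (w%:M : 'M[R]_1).
Proof.
apply/matrixP => i j; rewrite (ord1 j) -(splitK (i : 'I_(3 + 1))).
case: (fintype.split _) => k; rewrite /unsplit ?(@col_mxEu R 3 1 1) ?(@col_mxEd R 3 1 1) !mxE /=.
  by case: k => -[|[|[|//]]].
by rewrite (ord1 k) /= mulr1n.
Qed.

Lemma mulmx_hvec_ext (A B : 'M[R]_4) :
  (forall x y z w, A *m hvec x y z w = B *m hvec x y z w) -> A = B.
Proof.
move=> AB; apply/matrixP => i j.
have : A *m delta_mx j (0 : 'I_1) = B *m delta_mx j 0.
  by have [x [y [z [w ->]]]] := hvecP (delta_mx j 0 : 'cV[R]_4).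
by rewrite -!colE => /matrixP/(_ i 0); rewrite !mxE.
Qed.

Definition mx4 (c0 c1 c2 c3 : 'cV[R]_4) : 'M[R]_4 :=
  \matrix_(i, j) ([:: c0; c1; c2; c3]`_j) i 0.

Lemma mx4_hvec c0 c1 c2 c3 x y z w :
  mx4 c0 c1 c2 c3 *m hvec x y z w = x *: c0 + y *: c1 + z *: c2 + w *: c3.
Proof.
apply/matrixP => i j; rewrite (ord1 j) !mxE !big_ord_recl big_ord0 !mxE /=.
by ring.
Qed.

(** A square matrix with a right inverse is invertible. Testing the product on [hvec] reduces each
    use to identities between coordinates. *)
Lemma unitmx_hvec (A B : 'M[R]_4) :
  (forall x y z w, A *m (B *m hvec x y z w) = hvec x y z w) -> A \in unitmx.
Proof.
move=> AB; suff /mulmx1_unit[] : A *m B = 1%:M by [].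
by apply: mulmx_hvec_ext => x y z w; rewrite -mulmxA AB mul1mx.
Qed.

Lemma affine_ptE x y z : affine_pt (vec3 x y z) = hvec x y z 1.
Proof. by rewrite hvec_col_mx. Qed.

Lemma infinite_ptE x y z : infinite_pt (vec3 x y z) = hvec x y z 0.
Proof. by rewrite hvec_col_mx raddf0. Qed.

Lemma span2P (u v e : 'cV[R]_4) :
  reflect (exists s t, e = s *: u + t *: v) (e \in <<[:: u; v]>>)%VS.
Proof.
rewrite span_cons span_seq1; apply: (iffP idP).
  by move=> /memv_addP[_ /vlineP[s ->] [_ /vlineP[t ->] ->]]; exists s, t.
by move=> [s [t ->]]; rewrite memv_add ?memvZ ?memv_line.
Qed.

(** Here and in the next two lemmas spanning vectors give way to linear equations, so that
    membership questions become ring identities. *)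
Lemma mem_Zline x y z w :
  hvec x y z w \in val (Zline R) <-> x = 0 /\ y = 0.
Proof.
have -> : val (Zline R) = <<[:: hvec 0 0 0 1; hvec 0 0 1 0]>>%VS.
  rewrite /= -affine_ptE -infinite_ptE; congr (<<[:: affine_pt _; _]>>%VS).
  by apply/matrixP => i j; rewrite !mxE; case: i => -[|[|[|]]].
split=> [/span2P[s [t]]|[-> ->]].
  by rewrite !hvecZ hvecD => /hvec_inj[-> -> _ _]; rewrite !mulr0 addr0.
by apply/span2P; exists w, z; rewrite !hvecZ hvecD; congr hvec; ring.
Qed.

Lemma mem_Vline x y z w :
  hvec x y z w \in val (Vline R) <-> z = 0 /\ w = 0.
Proof.
rewrite /= !infinite_ptE; split=> [/span2P[s [t]]|[-> ->]].
  by rewrite !hvecZ hvecD => /hvec_inj[_ _ -> ->]; rewrite !mulr0 addr0.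
by apply/span2P; exists x, y; rewrite !hvecZ hvecD; congr hvec; ring.
Qed.

Lemma mem_ruling r a b x y z w :
  hvec x y z w \in val (ruling r a b) <-> x = r * w /\ z = b * w + a * y.
Proof.
rewrite /= affine_ptE infinite_ptE; split=> [/span2P[s [t]]|[-> ->]].
  by rewrite !hvecZ hvecD => /hvec_inj[-> -> -> ->]; split; ring.
by apply/span2P; exists w, y; rewrite !hvecZ hvecD; congr hvec; ring.
Qed.

Lemma line_eqP L M : (val L <= val M)%VS -> L = M.
Proof.
move=> LM; apply: val_inj; apply/eqP.
by rewrite eqEdim LM (eqP (valP L)) (eqP (valP M)).
Qed.

Lemma line_ext L M : (forall v, (v \in val L) = (v \in val M)) -> L = M.
Proof. by move=> LM; apply: line_eqP; apply/subvP => v; rewrite LM. Qed.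

Lemma mem_GL_line g L (v : 'cV[R]_4) :
  (v \in val (GL_line g L)) = (invmx (val g) *m v \in val L).
Proof.
apply/memv_imgP/idP => [[u uL ->]|vL].
  by rewrite lfunE /= mulKmx ?(valP g).
by exists (invmx (val g) *m v); rewrite // lfunE /= mulKVmx ?(valP g).
Qed.

Lemma mem_GL_line_mul g L (v : 'cV[R]_4) :
  (val g *m v \in val (GL_line g L)) = (v \in val L).
Proof. by rewrite mem_GL_line mulKmx ?(valP g). Qed.

Lemma GL_line_mul g h L : GL_line (g * h)%g L = GL_line g (GL_line h L).
Proof.
apply: line_ext => v; rewrite !mem_GL_line mulmxA.
by rewrite -!GL_valV -GL_valM invgM.
Qed.

Lemma GL_line_one L : GL_line 1%g L = L.
Proof.
by apply: line_ext => v; rewrite mem_GL_line /= invmx1 mul1mx.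
Qed.

Lemma collineateM (p q : PGL R 4) L :
  collineate (p * q)%g L = collineate p (collineate q L).
Proof.
rewrite -[p]repr_PGL -[q]repr_PGL.
have -> : (toPGL (repr p) * toPGL (repr q))%g = toPGL (repr p * repr q)%g.
  exact: toPGL_mul.
by rewrite !collineate_toPGL GL_line_mul.
Qed.

Lemma collineate1 L : collineate 1%g L = L.
Proof. by rewrite -[1%g]/(toPGL 1%g) collineate_toPGL GL_line_one. Qed.

(** The explicit matrix behind [proj_ext A]; computing with it avoids the representative chosen by
    [repr]. *)
Definition affine_ext (A : GL R 3) : GL R 4 :=
  Sub (block_mx (val A) 0 0 1%:M : 'M[R]_(3 + 1)) (proj_ext_unit A).

Lemma affine_extM (A B : GL R 3) :
  affine_ext (A * B)%g = (affine_ext A * affine_ext B)%g.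
Proof.
apply/val_inj/esym.
apply: (etrans (@mulmx_block R 3 1 3 1 3 1 (val A) 0 0 1%:M (val B) 0 0 1%:M)).
by rewrite !mulmx0 !mul0mx !mulmx1 !addr0 add0r.
Qed.

Lemma proj_extM (A B : GL R 3) : proj_ext (A * B)%g = (proj_ext A * proj_ext B)%g.
Proof.
rewrite -[proj_ext (A * B)%g]/(toPGL (affine_ext (A * B)%g)) affine_extM.
by rewrite -toPGL_mul.
Qed.

Lemma proj_extE (A : GL R 3) L :
  collineate (proj_ext A) L = GL_line (affine_ext A) L.
Proof. exact: collineate_toPGL. Qed.

Lemma affine_ext_hvec (A : GL R 3) x y z w :
  val (affine_ext A) *m hvec x y z w = col_mx (val A *m vec3 x y z) (w%:M : 'M[R]_1).
Proof.
rewrite hvec_col_mx.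
apply: (etrans (@mul_block_col R 3 1 3 1 1 (val A) 0 0 1%:M (vec3 x y z) w%:M)).
by rewrite !mul0mx mul1mx addr0 add0r.
Qed.

Definition rot4 t : GL R 4 := affine_ext (rotz t).

Lemma rotz_vec3 t x y z : val (rotz t) *m vec3 x y z =
  vec3 (x * cos t - y * sin t) (x * sin t + y * cos t) z.
Proof.
apply/matrixP => i j; rewrite !mxE !big_ord_recl big_ord0 !mxE /=.
by case: i => -[|[|[|//]]] ? /=; rewrite ?mxE /=; ring.
Qed.

Lemma rot4_hvec t x y z w : val (rot4 t) *m hvec x y z w =
  hvec (x * cos t - y * sin t) (x * sin t + y * cos t) z w.
Proof. by rewrite affine_ext_hvec rotz_vec3 -hvec_col_mx. Qed.

Lemma halfturn_vec3 x y z : val (halfturn R) *m vec3 x y z = vec3 x (- y) (- z).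
Proof.
apply/matrixP => i j; rewrite !mxE !big_ord_recl big_ord0 !mxE /=.
by case: i => -[|[|[|//]]] ? /=; rewrite ?mxE /=; ring.
Qed.

Lemma halfturn_hvec x y z w : val (affine_ext (halfturn R)) *m hvec x y z w =
  hvec x (- y) (- z) w.
Proof. by rewrite affine_ext_hvec halfturn_vec3 -hvec_col_mx. Qed.

End Coordinates.

(** * Rotation-invariant spreads *)

Section Spreads.
Variable R : realType.
Implicit Types (x y z w s t r a b : R) (L M : line R) (C D : set (line R)).

(** Each point is spanned by a nonzero vector, so both spread axioms can be read on vectors; the
    rest of the proof uses this form. *)
Lemma spreadP C : spread C <->
  (forall v : 'cV[R]_4, v != 0 -> exists2 L, C L & v \in val L) /\
  (forall L M (v : 'cV[R]_4), C L -> C M -> v != 0 -> v \in val L -> v \in val M -> L = M).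
Proof.
split=> -[].
  move=> disj cov; split=> [v v0|L M v CL CM v0 vL vM].
    have dv : \dim <[v]>%VS == 1%N by rewrite dim_vline v0.
    by have [L CL] := cov (Sub <[v]>%VS dv); rewrite /incident /= -memvE; exists L.
  apply: contrapT => LM; apply: (disj _ _ CL CM LM).
  have dv : \dim <[v]>%VS == 1%N by rewrite dim_vline v0.
  by exists (Sub <[v]>%VS dv); rewrite /incident /= -!memvE.
move=> cov uniq.
have pt (p : proj_point R) : exists2 v, v != 0 & val p = <[v]>%VS.
  exists (vpick (val p)).
    by rewrite vpick0 -dimv_eq0 (eqP (valP p)).
  apply/eqP; rewrite eq_sym eqEdim -memvE memv_pick /= (eqP (valP p)).
  by rewrite dim_vline vpick0 -dimv_eq0 (eqP (valP p)).
split=> [L M CL CM LM [p [pL pM]]|p].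
  have [v v0 pv] := pt p; apply: LM; apply: (uniq _ _ v CL CM v0).
    by rewrite memvE -pv.
  by rewrite memvE -pv.
have [v v0 pv] := pt p; have [L CL vL] := cov v v0.
by exists L => //; rewrite /incident pv -memvE.
Qed.

Lemma spread_collineate (p : PGL R 4) C :
  spread C -> spread (collineate p @` C).
Proof.
move=> /spreadP[cov uniq].
have pE L : collineate p L = GL_line (repr p) L by [].
have inj0 (v : 'cV[R]_4) : v != 0 -> invmx (val (repr p)) *m v != 0.
  apply: contra_neq => E; rewrite -[v](mulKVmx (valP (repr p))).
  by rewrite E mulmx0.
apply/spreadP; split=> [v /inj0 /cov[L CL vL]|_ _ v [L CL <-] [M CM <-] v0].
  by exists (collineate p L); [exists L|rewrite pE mem_GL_line].
rewrite !pE !mem_GL_line => vL vM.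
by rewrite (uniq _ _ _ CL CM (inj0 _ v0) vL vM).
Qed.

(** The angle [acos (x / r)] has the right cosine and a nonnegative sine; the sign of [y] decides
    between it and its negative. *)
Lemma polar x y r : 0 < r -> x ^+ 2 + y ^+ 2 = r ^+ 2 ->
  exists t, x = r * cos t /\ y = r * sin t.
Proof.
move=> r0 E.
have r1 : r != 0 by rewrite gt_eqF.
have x1 : x / r = cos (acos (x / r)) /\ Num.sqrt (1 - (x / r) ^+ 2) = sin (acos (x / r)).
  have xr : -1 <= x / r <= 1.
    rewrite ler_pdivlMr // ler_pdivrMr // mulN1r mul1r -ler_norml.
    by rewrite -(@ler_pXn2r _ 2) ?nnegrE ?(ltW r0) // real_normK ?num_real // -E lerDl sqr_ge0.
  by rewrite sin_acos // acosK.
have yE : Num.sqrt (1 - (x / r) ^+ 2) = `|y| / r.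
  rewrite -(@ger0_norm _ (`|y| / r)) ?divr_ge0 ?(ltW r0) // -sqrtr_sqr; congr Num.sqrt.
  rewrite !exprMn real_normK ?num_real //.
  have -> : y ^+ 2 = r ^+ 2 - x ^+ 2 by rewrite -E; ring.
  by field.
case: x1 => x1; rewrite yE => y1.
have [y0|y0] := leP 0 y.
  exists (acos (x / r)); rewrite -x1 -y1 ger0_norm //; split; by field.
exists (- acos (x / r)); rewrite cosN sinN -x1 -y1 ltr0_norm //; split; by field.
Qed.

Lemma hvec_neq0 x y z w :
  [\/ x != 0, y != 0, z != 0 | w != 0] -> hvec x y z w != 0.
Proof.
move=> H; apply/eqP; rewrite -hvec0 => /hvec_inj[x0 y0 z0 w0].
by case: H; rewrite ?x0 ?y0 ?z0 ?w0 eqxx.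
Qed.

Lemma sqrD_gt0 x y : ~ (x = 0 /\ y = 0) -> 0 < x ^+ 2 + y ^+ 2.
Proof.
move=> xy; rewrite lt0r addr_ge0 ?sqr_ge0 // andbT.
by apply/eqP => /eqP; rewrite paddr_eq0 ?sqr_ge0 // !sqrf_eq0 => /andP[/eqP ? /eqP ?]; exact: xy.
Qed.

(** A line that misses [Vline] is a complement of it, as 2 + 2 = 4; decomposing [hvec 0 0 z w] along
    the two gives the required vector. *)
Lemma line_graph L : (forall x y, hvec x y 0 0 \in val L -> x = 0 /\ y = 0) ->
  forall z w, exists x y, hvec x y z w \in val L.
Proof.
move=> LV z w.
have LV0 : (val L :&: val (Vline R) = 0)%VS.
  apply/eqP; rewrite -subv0; apply/subvP => v; rewrite memv_cap memv0.
  have [x [y [z' [w' ->]]]] := hvecP v.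
  move=> /andP[vL /mem_Vline[z0 w0]]; move: vL; rewrite z0 w0.
  by move=> /LV[-> ->]; rewrite hvec0.
have full : (val L + val (Vline R))%VS = fullv.
  apply/eqP; rewrite eqEdim subvf dimv_disjoint_sum // dimvf.
  by rewrite (eqP (valP L)) (eqP (valP (Vline R))).
have := memvf (hvec 0 0 z w); rewrite -full => /memv_addP[l lL [v vV E]].
have [x [y [z' [w' vE]]]] := hvecP v; move: vV E; rewrite vE => /mem_Vline[-> ->] E.
exists (- x), (- y); suff <- : l = hvec (- x) (- y) z w by [].
rewrite -[l](addrK (hvec x y 0 0)) -E -[X in _ - X]scale1r -scaleNr hvecZ hvecD.
by congr hvec; ring.
Qed.

End Spreads.

Section RotationInvariantSpreads.
Variables (R : realType) (D : set (line R)).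
Hypothesis Dspread : spread D.
Hypothesis Drot : forall t L, D L -> D (GL_line (rot4 t) L).
Implicit Types (x y z w s t r a b : R) (L M : line R).

Let Dcov (v : 'cV[R]_4) : v != 0 -> exists2 L, D L & v \in val L.
Proof. by have [cov _] := (spreadP D).1 Dspread; exact: cov. Qed.

Lemma meet_eq L M (v : 'cV[R]_4) :
  D L -> D M -> v != 0 -> v \in val L -> v \in val M -> L = M.
Proof. by have [_ uniq] := (spreadP D).1 Dspread; exact: uniq. Qed.

(** The origin is fixed by every rotation, hence so is the spread line [L] through it. If [L] left
    the axis, half the difference of a vector and its image under [rot4 pi] would be a horizontal
    direction in [L]; with its quarter turn this spans [Vline], which misses the origin. *)
Lemma Zline_in_spread : D (Zline R).
Proof.
have e0 : hvec 0 0 0 1 != 0 :> 'cV[R]_4.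
  by apply: hvec_neq0; apply: Or44; rewrite oner_eq0.
have [L DL eL] := Dcov e0.
have rotL t (v : 'cV[R]_4) : v \in val L -> val (rot4 t) *m v \in val L.
  move=> vL; suff <- : GL_line (rot4 t) L = L by rewrite mem_GL_line_mul.
  apply: (meet_eq (Drot t DL) DL e0 _ eL).
  rewrite -[hvec _ _ _ _](_ : val (rot4 t) *m hvec 0 0 0 1 = _) ?mem_GL_line_mul //.
  by rewrite rot4_hvec !mul0r subr0 addr0.
suff -> : Zline R = L by [].
apply/esym/line_eqP/subvP => v; have [x [y [z [w ->]]]] := hvecP v => vL.
apply/mem_Zline; apply: contrapT => xy.
have q0 := sqrD_gt0 xy.
have := rotL pi _ vL; rewrite rot4_hvec cospi sinpi => v1.
have u1 : hvec x y 0 0 \in val L.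
  rewrite (_ : hvec x y 0 0 = 2^-1 *: (hvec x y z w -
    hvec (x * -1 - y * 0) (x * 0 + y * -1) z w)).
    by rewrite memvZ // memvB.
  by rewrite -scaleN1r hvecZ hvecD hvecZ; congr hvec; field.
have := rotL (pi / 2) _ u1; rewrite rot4_hvec cos_pihalf sin_pihalf => u2.
have LV : (val (Vline R) <= val L)%VS.
  apply/subvP => u; have [x' [y' [z' [w' ->]]]] := hvecP u => /mem_Vline[-> ->].
  (* These are the coordinates of [(x', y')] in the orthogonal basis formed by [(x, y)] and its
     quarter turn [(- y, x)]. *)
  rewrite (_ : hvec _ _ _ _ =
    ((x' * x + y' * y) / (x ^+ 2 + y ^+ 2)) *: hvec x y 0 0 +
    ((y' * x - x' * y) / (x ^+ 2 + y ^+ 2)) *: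
      hvec (x * 0 - y * 1) (x * 1 + y * 0) 0 0).
    by rewrite memvD ?memvZ.
  by rewrite !hvecZ hvecD; congr hvec; field; rewrite gt_eqF.
have E := line_eqP LV; move: eL; rewrite -E => /mem_Vline[_ /eqP].
by rewrite oner_eq0.
Qed.

(** The rotation by [pi] fixes the point at infinity of the x-axis, hence the spread line [L]
    through it. Averaging a vector of [L] with its image kills [x] and [y]; a nonzero average would
    be a point of [Zline] and force [L] to be [Zline]. *)
Lemma Vline_in_spread : D (Vline R).
Proof.
have e0 : hvec 1 0 0 0 != 0 :> 'cV[R]_4.
  by apply: hvec_neq0; apply: Or41; rewrite oner_eq0.
have [L DL eL] := Dcov e0.
have LE : GL_line (rot4 pi) L = L.
  apply: (meet_eq (Drot pi DL) DL e0 _ eL).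
  rewrite (_ : hvec 1 0 0 0 = val (rot4 pi) *m ((-1) *: hvec 1 0 0 0)).
    by rewrite mem_GL_line_mul memvZ.
  by rewrite hvecZ rot4_hvec cospi sinpi; congr hvec; ring.
suff -> : Vline R = L by [].
apply/esym/line_eqP/subvP => v; have [x [y [z [w ->]]]] := hvecP v => vL.
apply/mem_Vline; apply: contrapT => zw.
have : val (rot4 pi) *m hvec x y z w \in val L by rewrite -LE mem_GL_line_mul.
rewrite rot4_hvec cospi sinpi => v1.
have u1 : hvec 0 0 z w \in val L.
  rewrite (_ : hvec 0 0 z w = 2^-1 *: (hvec x y z w +
    hvec (x * -1 - y * 0) (x * 0 + y * -1) z w)).
    by rewrite memvZ // memvD.
  by rewrite hvecD hvecZ; congr hvec; field.
have u0 : hvec 0 0 z w != 0.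
  by apply/eqP; rewrite -hvec0 => /hvec_inj[_ _ z0 w0]; exact: zw.
have LZ : L = Zline R.
  by apply: (meet_eq DL Zline_in_spread u0 u1); apply/mem_Zline.
by move: eL; rewrite LZ => /mem_Zline[/eqP]; rewrite oner_eq0.
Qed.

Lemma Vline_disjoint L x y :
  D L -> L <> Vline R -> hvec x y 0 0 \in val L -> x = 0 /\ y = 0.
Proof.
move=> DL LV vL; apply: contrapT => xy; apply: LV.
apply: (meet_eq DL Vline_in_spread _ vL); last exact/mem_Vline.
by apply/eqP; rewrite -hvec0 => /hvec_inj[x0 y0 _ _]; exact: xy.
Qed.

Lemma Zline_disjoint L z w :
  D L -> L <> Zline R -> hvec 0 0 z w \in val L -> z = 0 /\ w = 0.
Proof.
move=> DL LZ vL; apply: contrapT => zw; apply: LZ.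
apply: (meet_eq DL Zline_in_spread _ vL); last exact/mem_Zline.
by apply/eqP; rewrite -hvec0 => /hvec_inj[_ _ z0 w0]; exact: zw.
Qed.

(* The ruling is found from the point of [L] nearest to the z-axis. *)
Lemma rotated_ruling L : D L -> L <> Zline R -> L <> Vline R ->
  exists t r a b, [/\ 0 < r, a != 0 & L = GL_line (rot4 t) (ruling r a b)].
Proof.
move=> DL LZ LV.
(* [L] is spanned by its direction [(p, q, 1)] and its point [(x0, y0, 0)]. *)
have graph := line_graph (fun x y => @Vline_disjoint L x y DL LV).
have [p [q pqL]] := graph 1 0; have [x0 [y0 xyL]] := graph 0 1.
have pq0 : 0 < p ^+ 2 + q ^+ 2.
  apply: sqrD_gt0; move=> [p0 q0].
  move: pqL; rewrite p0 q0 => /(Zline_disjoint DL LZ)[/eqP].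
  by rewrite oner_eq0.
(* The height at which the squared distance to the z-axis is minimal; there [(x, y)] is orthogonal
   to [(p, q)]. *)
pose b := - (p * x0 + q * y0) / (p ^+ 2 + q ^+ 2).
pose x := b * p + x0; pose y := b * q + y0.
have uL : hvec x y b 1 \in val L.
  rewrite (_ : hvec x y b 1 = b *: hvec p q 1 0 + hvec x0 y0 0 1) ?memvD ?memvZ //.
  by rewrite hvecZ hvecD; congr hvec; ring.
have xypq : x * p + y * q = 0.
  by rewrite /x /y /b; field; rewrite gt_eqF.
have xy0 : 0 < x ^+ 2 + y ^+ 2.
  apply: sqrD_gt0; move=> [x00 y00].
  move: uL; rewrite x00 y00 => /(Zline_disjoint DL LZ)[_ /eqP].
  by rewrite oner_eq0.
pose r := Num.sqrt (x ^+ 2 + y ^+ 2).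
have r0 : 0 < r by rewrite sqrtr_gt0.
have [|t [xt yt]] := @polar _ x y _ r0; first by rewrite sqr_sqrtr // ltW.
have cs := cos2Dsin2 t.
have pqt : p * cos t + q * sin t = 0.
  apply: (mulfI (lt0r_neq0 r0)); rewrite mulr0 -xypq xt yt; ring.
(* Being orthogonal to [(cos t, sin t)], the vector [(p, q)] is [k] times [(- sin t, cos t)].
   Rotated back, the direction is [(0, k, 1)], of slope [k^-1]. *)
pose k := q * cos t - p * sin t.
have pE : p = - k * sin t.
  transitivity (p * (cos t ^+ 2 + sin t ^+ 2) - cos t * (p * cos t + q * sin t)).
    by rewrite cs pqt; ring.
  by rewrite /k; ring.
have qE : q = k * cos t.
  transitivity (q * (cos t ^+ 2 + sin t ^+ 2) - sin t * (p * cos t + q * sin t)).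
    by rewrite cs pqt; ring.
  by rewrite /k; ring.
have k0 : k != 0.
  by apply: contraTneq pq0 => k0; rewrite pE qE k0 oppr0 !mul0r !expr0n addr0 ltxx.
exists t, r, k^-1, b; split; rewrite ?invr_eq0 //.
apply/esym/line_eqP/subvP => v; rewrite mem_GL_line.
have {2}-> : v = val (rot4 t) *m (invmx (val (rot4 t)) *m v).
  by rewrite mulKVmx ?(valP (rot4 t)).
have [x' [y' [z' [w' ->]]]] := hvecP (invmx (val (rot4 t)) *m v).
move=> /mem_ruling[-> ->]; rewrite rot4_hvec.
rewrite (_ : hvec _ _ _ _ = w' *: hvec x y b 1 + (k^-1 * y') *: hvec p q 1 0).
  by rewrite memvD ?memvZ.
rewrite !hvecZ hvecD xt yt pE qE; congr hvec; field => //.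
Qed.

End RotationInvariantSpreads.

(** * Waist radii *)

Section Parabolas.
Variable R : realType.
Implicit Types (x y z w s t r a b c : R).

Lemma poly_sign_change (p : {poly R}) x y :
  0 < p.[x] -> p.[y] <= 0 -> exists z, p.[z] = 0.
Proof.
move=> px py; have [xy|/ltW yx] := leP x y.
  have [|z _ /rootP] := @poly_ivt _ (- p) x y xy.
    by rewrite !hornerN oppr_le0 oppr_ge0 (ltW px).
  by rewrite hornerN => /eqP; rewrite oppr_eq0 => /eqP; exists z.
by have [|z _ /rootP] := @poly_ivt _ p y x yx; [rewrite py ltW|exists z].
Qed.

(** For nonzero [a], the squared distance from the z-axis of the point at height [z] on
    [ruling r a b]. *)
Definition parab r a b z := r ^+ 2 + ((z - b) / a) ^+ 2.

Lemma parab_le r a b c z : a != 0 -> r ^+ 2 <= c -> (parab r a b z <= c) =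
  (b - `|a| * Num.sqrt (c - r ^+ 2) <= z <= b + `|a| * Num.sqrt (c - r ^+ 2)).
Proof.
move=> a0 rc.
rewrite -ler_distl /parab -lerBrDl exprMn exprVn.
rewrite ler_pdivrMr ?exprn_even_gt0 //.
rewrite -[RHS](@ler_pXn2r _ 2) ?nnegrE ?mulr_ge0 ?sqrtr_ge0 //.
by rewrite exprMn !real_normK ?num_real // sqr_sqrtr ?subr_ge0 // mulrC.
Qed.

(** An abstract family of parabolas whose graphs partition the open upper half plane; it is later
    instantiated by the rulings in the spread. *)
Variable F : R -> R -> R -> Prop.
Hypothesis Fa : forall r a b, F r a b -> a != 0.
Hypothesis Fr : forall r a b, F r a b -> 0 < r.
Hypothesis Fcov : forall z c, 0 < c ->
  exists r a b, F r a b /\ parab r a b z = c.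
Hypothesis Funiq : forall r a b r' a' b' z, F r a b -> F r' a' b' ->
  parab r a b z = parab r' a' b' z -> [/\ r = r', a = a' & b = b'].

(** Were the order reversed at [z], the difference, a polynomial, would have a zero. The graphs
    would meet there, and [Funiq] would identify the two parabolas. *)
Lemma parab_lt r a b r' a' b' y z : F r a b -> F r' a' b' ->
  parab r a b y < parab r' a' b' y -> parab r a b z < parab r' a' b' z.
Proof.
move=> Fg Fh gh; rewrite ltNge; apply/negP => hg.
pose P r a b : {poly R} := (r ^+ 2)%:P + (('X - b%:P) * (a^-1)%:P) ^+ 2.
have PE r0 a0 b0 x : (P r0 a0 b0).[x] = parab r0 a0 b0 x.
  by rewrite /P /parab !hornerE.
have [||x] := @poly_sign_change (P r' a' b' - P r a b) y z.
- by rewrite hornerD hornerN !PE subr_gt0.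
- by rewrite hornerD hornerN !PE subr_le0.
rewrite hornerD hornerN !PE => /eqP; rewrite subr_eq0 => /eqP E.
have [Er Ea Eb] := Funiq Fh Fg E.
by move: gh; rewrite Er Ea Eb ltxx.
Qed.

Lemma parab_le_total r a b r' a' b' : F r a b -> F r' a' b' ->
  (forall z, parab r a b z <= parab r' a' b' z) \/
  (forall z, parab r' a' b' z <= parab r a b z).
Proof.
move=> Fg Fh; case: (ltgtP (parab r a b 0) (parab r' a' b' 0)) => E.
- by left=> z; exact: ltW (parab_lt z Fg Fh E).
- by right=> z; exact: ltW (parab_lt z Fh Fg E).
by have [-> -> ->] := Funiq Fg Fh E; left.
Qed.

(* For [c = r^2] the sublevel sets [{z | g z <= c}] are nested compact
   intervals, hence share a point [z0]. The parabola through [(z0, c)] has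
   minimum [c]: otherwise the parabola through the point of height [c] above its
   vertex would lie above it and miss [z0]. *)
Lemma parab_min_surj r : 0 < r -> exists a b, F r a b.
Proof.
move=> r0; pose c := r ^+ 2; have c0 : 0 < c by rewrite exprn_gt0.
have le_c r1 a b z : parab r1 a b z <= c -> r1 ^+ 2 <= c.
  by apply: le_trans; rewrite lerDl sqr_ge0.
pose rad r1 a := `|a| * Num.sqrt (c - r1 ^+ 2).
have rad0 r1 a : 0 <= rad r1 a by rewrite mulr_ge0 ?sqrtr_ge0.
pose Lo := [set l | exists r1 a b, [/\ F r1 a b, r1 ^+ 2 <= c & l = b - rad r1 a]].
(* Of two comparable parabolas the upper one has the smaller sublevel interval, so every left end is
   at most every right end. Hence the supremum of the left ends lies in all the intervals. *)
have lo_hi r1 a b r2 a' b' : F r1 a b -> F r2 a' b' ->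
    r1 ^+ 2 <= c -> r2 ^+ 2 <= c -> b - rad r1 a <= b' + rad r2 a'.
  move=> Fg Fh gc hc.
  have [gh|hg] := parab_le_total Fg Fh.
    have : parab r1 a b (b' + rad r2 a') <= c.
      apply: le_trans (gh _) _; rewrite (parab_le _ _ (Fa Fh)) // -/(rad _ _) lexx andbT.
      by have := rad0 r2 a'; lra.
    by rewrite (parab_le _ _ (Fa Fg)) // => /andP[].
  have : parab r2 a' b' (b - rad r1 a) <= c.
    apply: le_trans (hg _) _; rewrite (parab_le _ _ (Fa Fg)) // -/(rad _ _) lexx /=.
    by have := rad0 r1 a; lra.
  by rewrite (parab_le _ _ (Fa Fh)) // => /andP[].
have Lo0 : Lo !=set0.
  have [r1 [a [b [Fg gE]]]] := Fcov 0 c0.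
  exists (b - rad r1 a), r1, a, b; split=> //.
  by apply: (@le_c _ a b 0); rewrite gE.
pose z0 := sup Lo.
have z0_mem r1 a b : F r1 a b -> r1 ^+ 2 <= c -> parab r1 a b z0 <= c.
  move=> Fg gc; rewrite (parab_le _ _ (Fa Fg)) // -/(rad _ _).
  have ubLo : ubound Lo (b + rad r1 a).
    by move=> _ [r2 [a' [b' [Fh hc ->]]]]; exact: lo_hi.
  apply/andP; split; last exact: ge_sup.
  by apply: ub_le_sup; [exists (b + rad r1 a)|exists r1, a, b].
have [r1 [a [b [Fg gE]]]] := Fcov z0 c0.
have r1c : r1 ^+ 2 <= c by apply: (@le_c _ a b z0); rewrite gE.
suff E : r1 = r by exists a, b; rewrite -E.
apply/eqP; rewrite -(@eqrXn2 _ 2) ?(ltW (Fr Fg)) ?(ltW r0) //.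
rewrite eq_le r1c leNgt; apply/negP => r1_lt.
have [r2 [a' [b' [Fh hE]]]] := Fcov b c0.
have gh : parab r1 a b b < parab r2 a' b' b.
  by rewrite hE /parab subrr mul0r expr0n addr0.
have : parab r2 a' b' z0 <= c.
  by apply: z0_mem Fh _; apply: (@le_c _ a' b' b); rewrite hE.
by rewrite leNgt -gE (parab_lt _ Fg Fh gh).
Qed.

End Parabolas.

(** * Waist functions of a rotation-invariant spread *)

Section SignedSpreads.
Variables (R : realType) (D : set (line R)).
Hypothesis Dspread : spread D.
Hypothesis Drot : forall t L, D L -> D (GL_line (rot4 t) L).
Implicit Types (x y z w s t r a b : R) (L M : line R).

Lemma rot4K t L : GL_line (rot4 (- t)) (GL_line (rot4 t) L) = L.
Proof.
rewrite -GL_line_mul -[RHS]GL_line_one; apply: (congr1 (fun g => GL_line g L)).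
apply: val_inj; apply: mulmx_hvec_ext => x y z w.
rewrite [RHS]mul1mx GL_valM -mulmxA !rot4_hvec cosN sinN; have cs := cos2Dsin2 t.
congr hvec.
  by transitivity (x * (cos t ^+ 2 + sin t ^+ 2)); [ring|rewrite cs mulr1].
by transitivity (y * (cos t ^+ 2 + sin t ^+ 2)); [ring|rewrite cs mulr1].
Qed.

(** The sign of [a], which encodes the handedness, is left open at this stage. *)
Definition ruling_in r a b := [/\ D (ruling r a b), 0 < r & a != 0].

Lemma rotated_ruling_in L : D L -> L <> Zline R -> L <> Vline R ->
  exists t r a b, ruling_in r a b /\ L = GL_line (rot4 t) (ruling r a b).
Proof.
move=> DL LZ LV.
have [t [r [a [b [r0 a0 LE]]]]] := rotated_ruling Dspread Drot DL LZ LV.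
exists t, r, a, b; do 2?split=> //.
by rewrite -(rot4K t (ruling r a b)) -LE; exact: Drot.
Qed.

(** The spread line through [(sqrt c, 0, z)] is a rotated ruling, and rotating it back changes
    neither the height nor the distance to the axis. *)
Lemma parab_cov z c : 0 < c -> exists r a b, ruling_in r a b /\ parab r a b z = c.
Proof.
move=> c0; have [cov _] := (spreadP D).1 Dspread.
have s0 : 0 < Num.sqrt c by rewrite sqrtr_gt0.
have [|L DL vL] := cov (hvec (Num.sqrt c) 0 z 1).
  by apply: hvec_neq0; apply: Or41; rewrite gt_eqF.
have [||t [r [a [b [ri LE]]]]] := rotated_ruling_in DL.
- by move=> E; move: vL s0; rewrite E => /mem_Zline[-> _]; rewrite ltxx.
- by move=> E; move: vL; rewrite E => /mem_Vline[_ /eqP]; rewrite oner_eq0.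
exists r, a, b; split=> //; have [_ r0 a0] := ri.
move: vL; rewrite LE mem_GL_line.
have [x [y [z' [w vE]]]] := hvecP (invmx (val (rot4 t)) *m hvec (Num.sqrt c) 0 z 1).
rewrite vE; have := congr1 (mulmx (val (rot4 t))) vE.
rewrite mulKVmx ?(valP (rot4 t)) // rot4_hvec => /hvec_inj[xE yE <- <-].
move=> /mem_ruling[]; rewrite !mulr1 => xr zE.
have cs := cos2Dsin2 t.
rewrite /parab zE -xr (_ : (b + a * y - b) / a = y); last by field.
rewrite -[RHS]sqr_sqrtr ?(ltW c0) // xE.
transitivity ((x * cos t - y * sin t) ^+ 2 + (x * sin t + y * cos t) ^+ 2).
  transitivity ((x ^+ 2 + y ^+ 2) * (cos t ^+ 2 + sin t ^+ 2)); last by ring.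
  by rewrite cs mulr1.
by rewrite -yE expr0n addr0.
Qed.

(** The complex quotient of [x' + i y'] by [x + i y] has modulus 1; its real and imaginary parts are
    passed to [polar]. *)
Lemma rotate_circle x y x' y' : 0 < x ^+ 2 + y ^+ 2 ->
  x ^+ 2 + y ^+ 2 = x' ^+ 2 + y' ^+ 2 ->
  exists t, x' = x * cos t - y * sin t /\ y' = x * sin t + y * cos t.
Proof.
move=> xy0 E; pose q := x ^+ 2 + y ^+ 2.
have q0 : q != 0 by rewrite gt_eqF.
have [|t []] := @polar R ((x * x' + y * y') / q) ((x * y' - y * x') / q) 1 ltr01.
  transitivity (q * (x' ^+ 2 + y' ^+ 2) / q ^+ 2); first by rewrite /q; field.
  by rewrite -E -/q; field.
rewrite !mul1r => ct st; exists t; rewrite -ct -st; split.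
  by transitivity (q * x' / q); [field|rewrite /q; field].
by transitivity (q * y' / q); [field|rewrite /q; field].
Qed.

(** At height [z] the two rulings have points on a common circle about the axis. A rotation matches
    these points and hence the two spread lines; comparing equations shows that it is trivial. *)
Lemma parab_uniq r a b r' a' b' z : ruling_in r a b -> ruling_in r' a' b' ->
  parab r a b z = parab r' a' b' z -> [/\ r = r', a = a' & b = b'].
Proof.
move=> [Dg r0 a0] [Dh r'0 a'0] E.
have [|t [tx ty]] := rotate_circle _ E.
  by rewrite ltr_pwDl ?sqr_ge0 ?exprn_gt0.
have gh : GL_line (rot4 t) (ruling r a b) = ruling r' a' b'.
  apply: (meet_eq Dspread (Drot t Dg) Dh (v := hvec r' ((z - b') / a') z 1)).
  - by apply: hvec_neq0; apply: Or44; rewrite oner_eq0.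
  - rewrite tx ty -rot4_hvec mem_GL_line_mul; apply/mem_ruling.
    by split; [rewrite mulr1|field].
  - by apply/mem_ruling; split; [rewrite mulr1|field].
have : val (rot4 t) *m hvec r 0 b 1 \in val (ruling r' a' b').
  by rewrite -gh mem_GL_line_mul; apply/mem_ruling; split; ring.
have : val (rot4 t) *m hvec 0 1 a 0 \in val (ruling r' a' b').
  by rewrite -gh mem_GL_line_mul; apply/mem_ruling; split; ring.
rewrite !rot4_hvec => /mem_ruling[E1 E2] /mem_ruling[E3 E4].
have s0 : sin t = 0 by move: E1; lra.
(* The other value, -1, would give [r' = - r] against positivity. *)
have c1 : cos t = 1.
  have : (cos t - 1) * (cos t + 1) = 0.
    by have := cos2Dsin2 t; rewrite s0 => cs; rewrite -subr_sqr expr1n -cs; ring.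
  move=> /eqP; rewrite mulf_eq0 => /orP[/eqP|/eqP c1]; first by lra.
  by move: E3; rewrite (_ : cos t = -1) ?s0; [lra|move: c1; lra].
by move: E2 E3 E4; rewrite s0 c1; split; lra.
Qed.

(** Both rulings lie in the plane [x = r * w], so they share the point [v], which is a nonzero
    vector unless the parameters agree. *)
Lemma waist_uniq r a b a' b' : ruling_in r a b -> ruling_in r a' b' ->
  a = a' /\ b = b'.
Proof.
move=> [Dg r0 a0] [Dh _ a'0]; apply: contrapT => ab.
apply: ab; pose v := hvec (r * (a - a')) (b' - b) (a * b' - a' * b) (a - a').
suff E : ruling r a b = ruling r a' b'.
  have : hvec r 0 b 1 \in val (ruling r a' b').
    by rewrite -E; apply/mem_ruling; split; ring.
  have : hvec 0 1 a 0 \in val (ruling r a' b').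
    by rewrite -E; apply/mem_ruling; split; ring.
  by move=> /mem_ruling[_ E1] /mem_ruling[_ E2]; split; [move: E1|move: E2]; lra.
have [/eqP v0|v0] := boolP (v == 0).
  have [_ bb _ aa] : [/\ r * (a - a') = 0, b' - b = 0, a * b' - a' * b = 0 & a - a' = 0].
    by apply: hvec_inj; rewrite hvec0.
  by rewrite (_ : a = a') 1?(_ : b = b') //; lra.
by apply: (meet_eq Dspread Dg Dh v0); apply/mem_ruling; split; ring.
Qed.

Lemma collineate_rot t L : collineate (proj_ext (rotz t)) L = GL_line (rot4 t) L.
Proof. exact: proj_extE. Qed.

Lemma rotational_formP : (forall r a b, ruling_in r a b -> 0 < a) ->
  exists a b : R -> R,
    [/\ forall r, 0 < r -> 0 < a r, forall r, 0 < r -> D (ruling r (a r) (b r)) &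
        D = rotational_form a b].
Proof.
move=> apos.
have [f fP] : {f : R -> R * R & forall r, 0 < r -> ruling_in r (f r).1 (f r).2}.
  apply: (@choice _ _ (fun r ab => 0 < r -> ruling_in r ab.1 ab.2)) => r.
  (* Nothing is required for [r <= 0], where [(0, 0)] is an arbitrary value. *)
  have [r0|r0] := ltP 0 r; last by exists (0, 0).
  have [||a [b ri]] := @parab_min_surj R ruling_in _ _ parab_cov parab_uniq r r0.
  - by move=> ? ? ? [].
  - by move=> ? ? ? [].
  by exists (a, b).
exists (fun r => (f r).1), (fun r => (f r).2); split=> [r r0|r r0|].
- exact: apos (fP r r0).
- by have [] := fP r r0.
apply/seteqP; split=> L.
  move=> DL; have [->|LZ] := pselect (L = Zline R); first by left; left.
  have [->|LV] := pselect (L = Vline R); first by left; right.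
  have [t [r [a [b [ri ->]]]]] := rotated_ruling_in DL LZ LV.
  right; have [_ r0 _] := ri; exists r => //.
  by have [-> ->] := waist_uniq ri (fP r r0); exists t; rewrite ?collineate_rot.
move=> [[->|->]|[r r0 [t _ <-]]].
- exact: Zline_in_spread.
- exact: Vline_in_spread.
by rewrite collineate_rot; apply: Drot; have [] := fP r r0.
Qed.

End SignedSpreads.

(** * Topology of the line space *)

Section LineTopology.
Variable R : realType.
Implicit Types (x y z w s t r a b c : R) (L M : line R) (g h : GL R 4).

Lemma continuous_mx (T : topologicalType) m n (f : T -> 'M[R]_(m, n)) :
  (forall i j, continuous (fun p => f p i j)) -> continuous f.
Proof.
move=> fc p A [P Pf PA].
have : \forall q \near p, forall i j, P i j (f q i j).
  apply: filter_forall => i; apply: filter_forall => j.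
  exact: (fc i j p _ (Pf i j)).
by apply: filterS => q Pq; exact: PA.
Qed.

Lemma continuous_sum (T : topologicalType) n (f : 'I_n -> T -> R) :
  (forall i, continuous (f i)) -> continuous (fun p => \sum_i f i p).
Proof. by move=> fc; apply: continuous_big => //; exact: add_continuous. Qed.

Lemma continuous_mulmxl m n p (A : 'M[R]_(m, n)) i j :
  continuous (fun M : 'M[R]_(n, p) => (A *m M) i j).
Proof.
rewrite (_ : (fun X => _) = fun M : 'M[R]_(n, p) => \sum_k A i k * M k j); last first.
  by apply/funext => M; rewrite mxE.
apply: continuous_sum => k M.
by apply: continuousM; [exact: cst_continuous|exact: coord_continuous].
Qed.

Lemma continuous_mulmxr m n p (A : 'M[R]_(n, p)) i j :
  continuous (fun M : 'M[R]_(m, n) => (M *m A) i j).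
Proof.
rewrite (_ : (fun X => _) = fun M : 'M[R]_(m, n) => \sum_k M i k * A k j); last first.
  by apply/funext => M; rewrite mxE.
apply: continuous_sum => k M.
by apply: continuousM; [exact: coord_continuous|exact: cst_continuous].
Qed.

Lemma continuous_det n : continuous (fun A : 'M[R]_n => \det A).
Proof.
apply: continuous_big => [|s _ A]; first exact: add_continuous.
apply: (@continuousM R _ (fun=> (-1) ^+ perm.odd_perm s)
  (fun M : 'M[R]_n => \prod_i M i (perm.fun_of_perm s i))).
  exact: cst_continuous.
apply: continuous_big => [|i _]; first exact: mul_continuous.
exact: coord_continuous.
Qed.

(** The adjugate is polynomial in the entries, and replaces the inverse up to the determinant. *)
Lemma continuous_adj n i j : continuous (fun A : 'M[R]_n => \adj A i j).
Proof.
rewrite (_ : (fun X => _) =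
    fun A : 'M[R]_n => (-1) ^+ (j + i) * \det (row' j (col' i A))); last first.
  by apply/funext => A; rewrite mxE.
move=> A; apply: (@continuousM R _ (fun=> (-1) ^+ (j + i))
  (fun B : 'M[R]_n => \det (row' j (col' i B)))); first exact: cst_continuous.
apply: (@continuous_comp _ _ _ (fun B : 'M[R]_n => row' j (col' i B))
  (fun M : 'M[R]_n.-1 => \det M)); last exact: continuous_det.
apply: continuous_mx => k l.
rewrite (_ : (fun X => _) = fun B : 'M[R]_n => B (lift j k) (lift i l)).
  exact: coord_continuous.
by apply/funext => B; rewrite !mxE.
Qed.

Lemma continuous_GL_val : continuous (val : GL R 4 -> 'M[R]_4).
Proof. exact: initial_continuous. Qed.

Lemma continuous_to_GL (T : topologicalType) (f : T -> GL R 4) :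
  continuous (val \o f) -> continuous f.
Proof.
move=> /continuousP fc; apply/continuousP => _ [B oB <-].
by rewrite -comp_preimage; exact: fc.
Qed.

Lemma continuous_GL_mull h : continuous (fun g : GL R 4 => h * g)%g.
Proof.
apply: continuous_to_GL; apply: continuous_mx => i j g.
apply: (@continuous_comp _ _ _ (val : GL R 4 -> _)
  (fun M : 'M[R]_4 => (val h *m M) i j)); first exact: continuous_GL_val.
exact: continuous_mulmxl.
Qed.

Lemma continuous_GL_mulr h : continuous (fun g : GL R 4 => g * h)%g.
Proof.
apply: continuous_to_GL; apply: continuous_mx => i j g.
apply: (@continuous_comp _ _ _ (val : GL R 4 -> _)
  (fun M : 'M[R]_4 => (M *m val h) i j)); first exact: continuous_GL_val.
exact: continuous_mulmxr.
Qed.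

Definition qline g : line R := GL_line g (Zline R).

(** Two successive quotients, from [GL] to [PGL] and from [PGL] to lines, compose to one quotient,
    so topological arguments can be made with matrices. *)
Lemma open_qline (U : set (line R)) : open U = open (qline @^-1` U).
Proof.
rewrite -[open U]/(open ((fun g : GL R 4 => collineate (toPGL g) (Zline R)) @^-1` U)).
congr open; apply/funext => g /=; congr (U _); exact: collineate_toPGL.
Qed.

Lemma qline_mul g h : qline (g * h)%g = GL_line g (qline h).
Proof. exact: GL_line_mul. Qed.

Lemma continuous_GL_line g : continuous (GL_line g : line R -> line R).
Proof.
apply/continuousP => U; rewrite !open_qline => oU.
have /continuousP/(_ _ oU) := @continuous_GL_mull g.
by congr open; apply/funext => h /=; rewrite qline_mul.
Qed.

Lemma compact_GL_line g (C : set (line R)) : compact C -> compact (GL_line g @` C).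
Proof.
by apply: continuous_compact; apply: continuous_subspaceT; exact: continuous_GL_line.
Qed.

(* [qline] is an open map: the saturation of an open set is a union of its
   right translates by the stabilizer of [Zline]. *)
Lemma nbhs_qline g (U : set (GL R 4)) : nbhs g U -> nbhs (qline g) (qline @` U).
Proof.
rewrite nbhsE => -[W [oW Wg] WU].
have oqW : open (qline @` W).
  rewrite open_qline openE => h [k0 Wk0 kh].
  pose k := (h^-1 * k0)%g.
  have kZ : qline k = Zline R.
    by rewrite /k qline_mul kh -qline_mul mulVg; exact: GL_line_one.
  have : nbhs h ((fun g' => g' * k)%g @^-1` W).
    apply: continuous_GL_mulr; apply: open_nbhs_nbhs; split=> //.
    by rewrite /k mulgA mulgV mul1g.
  apply: filterS => g' Wg'; exists (g' * k)%g => //.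
  by rewrite qline_mul kZ.
apply: filterS (open_nbhs_nbhs (conj oqW _)); last by exists g.
by move=> _ [h Wh <-]; exists h => //; exact: WU.
Qed.

(** Openness of [qline] transfers a property valid near a matrix to all lines near its image; the
    parameter [r] is carried along for the compactness argument. *)
Lemma near_qline g r (P : R -> line R -> Prop) :
  (\forall g' \near g & r' \near r, P r' (qline g')) ->
  \forall L \near qline g & r' \near r, P r' L.
Proof.
move=> [[U V] [/= gU rV] UVP]; exists (qline @` U, V) => /=.
  by split=> //; exact: nbhs_qline.
by move=> [_ r'] [[/= g' Ug' <-] Vr']; exact: (UVP (g', r')).
Qed.

(** Membership means that the first two coordinates of the inverse of [g] applied to [hvec r 0 0 1]
    vanish. Multiplied by the determinant these are the functions [f], continuous in matrix and [r],
    so a nonzero one stays nonzero nearby. *)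
Lemma near_notin_qline g r : hvec r 0 0 1 \notin val (qline g) ->
  \forall g' \near g & r' \near r, hvec r' 0 0 1 \notin val (qline g').
Proof.
pose f (i : 'I_4) (A : 'M[R]_4 * R) : R :=
  (\adj A.1 *m hvec 1 0 0 0) i 0 * A.2 + (\adj A.1 *m hvec 0 0 0 1) i 0.
have fE h x i : f i (val h, x) = \det (val h) * (invmx (val h) *m hvec x 0 0 1) i 0.
  have -> : hvec x 0 0 1 = x *: hvec 1 0 0 0 + hvec 0 0 0 1.
    by rewrite hvecZ hvecD; congr hvec; ring.
  have d0 : \det (val h) != 0 by rewrite -unitfE -unitmxE (valP h).
  rewrite /f /invmx (valP h) -scalemxAl [in RHS]mxE mulrA divff // mul1r.
  by rewrite mulmxDr -scalemxAr [in RHS]mxE [in RHS]mxE mulrC.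
have memE h x : hvec x 0 0 1 \in val (qline h) <->
    f (inord 0) (val h, x) = 0 /\ f (inord 1) (val h, x) = 0.
  have d0 : \det (val h) != 0 by rewrite -unitfE -unitmxE (valP h).
  rewrite !fE /qline mem_GL_line.
  have [x' [y' [z' [w' ->]]]] := hvecP (invmx (val h) *m hvec x 0 0 1).
  rewrite !mxE !inordK //=; split=> [/mem_Zline[-> ->]|[]]; first by rewrite mulr0.
  move=> /eqP; rewrite mulf_eq0 (negbTE d0) => /eqP x0.
  move=> /eqP; rewrite mulf_eq0 (negbTE d0) => /eqP y0.
  exact/mem_Zline.
have fc i h x : f i (val p.1, p.2) @[p --> (h, x)] --> f i (val h, x).
  have vc : (val p.1 : 'M[R]_4) @[p --> (h, x)] --> (val h : 'M[R]_4).
    apply: (@cvg_comp _ _ _ fst (val : GL R 4 -> 'M[R]_4) _ (nbhs h)).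
      exact: cvg_fst.
    exact: continuous_GL_val.
  have ac (v : 'cV[R]_4) :
      (\adj (val p.1 : 'M[R]_4) *m v) i 0 @[p --> (h, x)] --> (\adj (val h) *m v) i 0.
    apply: (@cvg_comp _ _ _ _ (fun A : 'M[R]_4 => (\adj A *m v) i 0) _ _ _ vc).
    apply: (@continuous_comp _ _ _ (fun A : 'M[R]_4 => \adj A)
      (fun A : 'M[R]_4 => (A *m v) i 0)); last exact: continuous_mulmxr.
    by apply: continuous_mx => k l; exact: continuous_adj.
  by apply: cvgD => //; apply: cvgM => //; exact: cvg_snd.
have near0 i : (forall h x, hvec x 0 0 1 \in val (qline h) -> f i (val h, x) = 0) ->
    f i (val g, r) != 0 ->
    \forall g' \near g & r' \near r, hvec r' 0 0 1 \notin val (qline g').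
  move=> fi0 f0; have := cvgr_neq0 _ (fc i g r) f0 => /(_ _).
  apply: filterS => -[g' r'] /= f0'; apply/negP => /fi0 E.
  by rewrite E eqxx in f0'.
move=> gr; have : f (inord 0) (val g, r) != 0 \/ f (inord 1) (val g, r) != 0.
  apply: contrapT => /not_orP[/negP/negPn/eqP f0 /negP/negPn/eqP f1].
  by move/negP: gr; apply; exact/memE.
by case; apply: near0 => h x /memE[].
Qed.

(* Its sign is that of the determinant of the linear map from the [zw]-plane to the
   [xy]-plane whose graph is the span of [u] and [v]; it does not depend on the
   basis of that span. *)
Definition orientation (u v : 'cV[R]_4) : R :=
  (u (inord 0) 0 * v (inord 1) 0 - v (inord 0) 0 * u (inord 1) 0) *
  (u (inord 2) 0 * v (inord 3) 0 - v (inord 2) 0 * u (inord 3) 0).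

(** Taking [e] to be 1 or -1 treats both signs at once. *)
Definition oriented e L := exists u v : 'cV[R]_4,
  [/\ u \in val L, v \in val L & 0 < e * orientation u v].

(** Both factors of [orientation] are 2 by 2 minors, each multiplied by the determinant
    [a * d - b * c] of the change of vectors; their product changes by a square. *)
Lemma orientation_span e L (u v : 'cV[R]_4) :
  (forall p : 'cV[R]_4, p \in val L -> exists a b, p = a *: u + b *: v) ->
  oriented e L -> 0 < e * orientation u v.
Proof.
move=> Luv [_ [_ [/Luv[a [b ->]] /Luv[c [d ->]]]]].
rewrite (_ : orientation _ _ = (a * d - b * c) ^+ 2 * orientation u v); last first.
  by rewrite /orientation !mxE; ring.
rewrite mulrCA => H; move: (H); rewrite pmulr_rgt0 // lt0r sqr_ge0 andbT.
by apply: contraTneq H => ->; rewrite mul0r ltxx.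
Qed.

(** On the two vectors defining the ruling, [orientation] equals [- (r * a)]; so positive [a]
    corresponds to negative orientation. *)
Lemma ruling_orientation e r a b : 0 < r ->
  oriented e (ruling r a b) <-> 0 < - (e * a).
Proof.
move=> r0.
have E : e * orientation (hvec r 0 b 1) (hvec 0 1 a 0) = r * - (e * a).
  by rewrite /orientation !mxE !inordK //=; ring.
split.
  move=> /(@orientation_span _ _ (hvec r 0 b 1) (hvec 0 1 a 0)).
  rewrite E pmulr_rgt0 //; apply=> p; have [x [y [z [w ->]]]] := hvecP p.
  move=> /mem_ruling[-> ->]; exists w, y; rewrite !hvecZ hvecD.
  by congr hvec; ring.
move=> ea; exists (hvec r 0 b 1), (hvec 0 1 a 0); rewrite E pmulr_rgt0 //.
by split=> //; apply/mem_ruling; split; ring.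
Qed.

Lemma orientation_rot t (u v : 'cV[R]_4) :
  orientation (val (rot4 t) *m u) (val (rot4 t) *m v) = orientation u v.
Proof.
have [x [y [z [w ->]]]] := hvecP u; have [x' [y' [z' [w' ->]]]] := hvecP v.
rewrite !rot4_hvec /orientation !mxE !inordK //=; congr (_ * _).
transitivity ((x * y' - x' * y) * (cos t ^+ 2 + sin t ^+ 2)); first by ring.
by rewrite cos2Dsin2 mulr1.
Qed.

Lemma oriented_rot t e L : oriented e (GL_line (rot4 t) L) <-> oriented e L.
Proof.
have rot s M : oriented e M -> oriented e (GL_line (rot4 s) M).
  move=> [u [v [uM vM uv]]]; exists (val (rot4 s) *m u), (val (rot4 s) *m v).
  by rewrite !mem_GL_line_mul orientation_rot.
by split=> [/(rot (- t))|]; [rewrite rot4K|exact: rot].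
Qed.

(** [qline g] is spanned by the last two columns of [g], and their orientation is a continuous
    function of [g]. *)
Lemma near_oriented e g : oriented e (qline g) ->
  \forall g' \near g, oriented e (qline g').
Proof.
pose o (A : 'M[R]_4) := e * orientation (A *m hvec 0 0 0 1) (A *m hvec 0 0 1 0).
have oc : continuous o.
  have cc (v : 'cV[R]_4) i : continuous (fun A : 'M[R]_4 => (A *m v) i 0).
    exact: continuous_mulmxr.
  have cM (f h : 'M[R]_4 -> R) : continuous f -> continuous h ->
    continuous (fun A => f A * h A).
    by move=> cf ch A; apply: continuousM; [exact: cf|exact: ch].
  have cB (f h : 'M[R]_4 -> R) : continuous f -> continuous h ->
    continuous (fun A => f A - h A).
    by move=> cf ch A; apply: continuousB; [exact: cf|exact: ch].
  apply: (cM _ _); first exact: cst_continuous.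
  by apply: (cM _ _); apply: (cB _ _); apply: (cM _ _); exact: cc.
have eZ h v : v \in val (qline h) -> exists a b,
    v = a *: (val h *m hvec 0 0 0 1) + b *: (val h *m hvec 0 0 1 0).
  rewrite mem_GL_line -{2}[v](mulKVmx (valP h)).
  have [x [y [z [w ->]]]] := hvecP (invmx (val h) *m v).
  move=> /mem_Zline[-> ->]; exists w, z.
  by rewrite !scalemxAr -mulmxDr !hvecZ hvecD; congr (_ *m hvec _ _ _ _); ring.
move=> /(orientation_span (eZ g)) g0.
have oVc : {for g, continuous (o \o (val : GL R 4 -> 'M[R]_4))}.
  by apply: continuous_comp; [exact: continuous_GL_val|exact: oc].
have := cvgr_gt _ oVc _ g0 => /(_ _); apply: filterS => h h0.
exists (val h *m hvec 0 0 0 1), (val h *m hvec 0 0 1 0).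
by rewrite !mem_GL_line_mul; split=> //; apply/mem_Zline.
Qed.

Lemma GL_line_qline g L : (exists h, L = qline h) -> exists h, GL_line g L = qline h.
Proof. by move=> [h ->]; exists (g * h)%g; rewrite qline_mul. Qed.

End LineTopology.

(** * Orientation of the reguli *)

Section SpecialCollineations.
Variable R : realType.
Implicit Types (x y z w s t r a b c : R) (L M : line R) (g h : GL R 4).

Lemma GL_line_eq g L M :
  (forall x y z w, hvec x y z w \in val L -> val g *m hvec x y z w \in val M) ->
  GL_line g L = M.
Proof.
move=> gLM; apply/line_eqP/subvP => v; rewrite mem_GL_line => vL.
rewrite -[v](mulKVmx (valP g)).
by have [x [y [z [w E]]]] := hvecP (invmx (val g) *m v); move: vL; rewrite E; exact: gLM.
Qed.

Definition mkGL (A : 'M[R]_4) (uA : A \in unitmx) : GL R 4 := Sub A uA.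

Lemma mkGLE (A : 'M[R]_4) (uA : A \in unitmx) : val (mkGL uA) = A.
Proof. by []. Qed.

Lemma swap_unit : mx4 (hvec 0 0 1 0) (hvec 0 0 0 1) (hvec 1 0 0 0) (hvec 0 1 0 0)
  \in @unitmx R 4.
Proof.
apply: (@unitmx_hvec R _
  (mx4 (hvec 0 0 1 0) (hvec 0 0 0 1) (hvec 1 0 0 0) (hvec 0 1 0 0))) => x y z w.
by rewrite !(mx4_hvec, hvecZ, hvecD); congr hvec; ring.
Qed.

Lemma Vline_qline : exists g, Vline R = qline g.
Proof.
exists (mkGL swap_unit); apply/esym/GL_line_eq => x y z w /mem_Zline[-> ->].
rewrite mkGLE !(mx4_hvec, hvecZ, hvecD); apply/mem_Vline; split; ring.
Qed.

Lemma ruling_qline r a b : a != 0 -> exists g, ruling r a b = qline g.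
Proof.
(* The last two columns span the ruling; the first two complete them to a basis because [a] is
   nonzero. *)
move=> a0; pose A := mx4 (hvec 1 0 0 0) (hvec 0 1 0 0) (hvec 0 1 a 0) (hvec r 0 b 1).
have uA : A \in unitmx.
  apply: (@unitmx_hvec R _ (mx4 (hvec 1 0 0 0) (hvec 0 1 0 0)
    (hvec 0 (- a^-1) a^-1 0) (hvec (- r) (b / a) (- b / a) 1))) => x y z w.
  by rewrite /A !(mx4_hvec, hvecZ, hvecD); congr hvec; field.
exists (mkGL uA); apply/esym/GL_line_eq => x y z w /mem_Zline[-> ->].
rewrite mkGLE /A !(mx4_hvec, hvecZ, hvecD); apply/mem_ruling; split; ring.
Qed.

Lemma refl_unit : mx4 (hvec (-1) 0 0 0) (hvec 0 1 0 0) (hvec 0 0 1 0) (hvec 0 0 0 1)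
  \in @unitmx R 4.
Proof.
apply: (@unitmx_hvec R _
  (mx4 (hvec (-1) 0 0 0) (hvec 0 1 0 0) (hvec 0 0 1 0) (hvec 0 0 0 1))) => x y z w.
by rewrite !(mx4_hvec, hvecZ, hvecD); congr hvec; ring.
Qed.

Definition refl : GL R 4 := mkGL refl_unit.

Lemma refl_hvec x y z w : val refl *m hvec x y z w = hvec (- x) y z w.
Proof. by rewrite mkGLE !(mx4_hvec, hvecZ, hvecD); congr hvec; ring. Qed.

Lemma translz_unit c : mx4 (hvec 1 0 0 0) (hvec 0 1 0 0) (hvec 0 0 1 0) (hvec 0 0 c 1)
  \in @unitmx R 4.
Proof.
apply: (@unitmx_hvec R _
  (mx4 (hvec 1 0 0 0) (hvec 0 1 0 0) (hvec 0 0 1 0) (hvec 0 0 (- c) 1))) => x y z w.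
by rewrite !(mx4_hvec, hvecZ, hvecD); congr hvec; ring.
Qed.

(** Used to move a constant [b] to height 0, where the half-turn about the x-axis acts. *)
Definition translz c : GL R 4 := mkGL (translz_unit c).

Lemma translz_hvec c x y z w : val (translz c) *m hvec x y z w = hvec x y (z + c * w) w.
Proof. by rewrite mkGLE !(mx4_hvec, hvecZ, hvecD); congr hvec; ring. Qed.

Lemma GL_hvec_ext g h :
  (forall x y z w, val g *m hvec x y z w = val h *m hvec x y z w) -> g = h.
Proof. by move=> gh; apply: val_inj; exact: mulmx_hvec_ext. Qed.

(** The reflection normalizes the rotation group, so mirror images of rotation-invariant spreads are
    rotation-invariant. *)
Lemma rot4_refl t : (rot4 t * refl = refl * rot4 (- t))%g.
Proof.
apply: GL_hvec_ext => x y z w; rewrite !GL_valM -!mulmxA !(rot4_hvec, refl_hvec).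
by rewrite cosN sinN; congr hvec; ring.
Qed.

Lemma rot4_translz c t : (rot4 t * translz c = translz c * rot4 t)%g.
Proof.
apply: GL_hvec_ext => x y z w; rewrite !GL_valM -!mulmxA.
by rewrite !(rot4_hvec, translz_hvec).
Qed.

Lemma rot4_halfturn t :
  (rot4 t * affine_ext (halfturn R) = affine_ext (halfturn R) * rot4 (- t))%g.
Proof.
apply: GL_hvec_ext => x y z w; rewrite !GL_valM -!mulmxA !(rot4_hvec, halfturn_hvec).
by rewrite cosN sinN; congr hvec; ring.
Qed.

Lemma halfturn_refl :
  (affine_ext (halfturn R) * refl = refl * affine_ext (halfturn R))%g.
Proof.
apply: GL_hvec_ext => x y z w; rewrite !GL_valM -!mulmxA.
by rewrite !(halfturn_hvec, refl_hvec).
Qed.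

Lemma halfturn_halfturn L :
  GL_line (affine_ext (halfturn R)) (GL_line (affine_ext (halfturn R)) L) = L.
Proof.
rewrite -GL_line_mul -[RHS]GL_line_one; apply: (congr1 (fun g => GL_line g L)).
apply: GL_hvec_ext => x y z w; rewrite GL_valM -mulmxA !halfturn_hvec !opprK.
by rewrite [RHS]mul1mx.
Qed.

Lemma halfturn_ruling r a b :
  GL_line (affine_ext (halfturn R)) (ruling r a b) = ruling r a (- b).
Proof.
apply: GL_line_eq => x y z w /mem_ruling[-> ->]; rewrite halfturn_hvec.
by apply/mem_ruling; split=> //; ring.
Qed.

Lemma halfturn_Zline : GL_line (affine_ext (halfturn R)) (Zline R) = Zline R.
Proof.
apply: GL_line_eq => x y z w /mem_Zline[-> ->]; rewrite halfturn_hvec oppr0.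
exact/mem_Zline.
Qed.

Lemma halfturn_Vline : GL_line (affine_ext (halfturn R)) (Vline R) = Vline R.
Proof.
apply: GL_line_eq => x y z w /mem_Vline[-> ->]; rewrite halfturn_hvec oppr0.
exact/mem_Vline.
Qed.

Lemma rot4_Zline t : GL_line (rot4 t) (Zline R) = Zline R.
Proof.
apply: GL_line_eq => x y z w /mem_Zline[-> ->]; rewrite rot4_hvec.
by apply/mem_Zline; split; ring.
Qed.

Lemma rot4_Vline t : GL_line (rot4 t) (Vline R) = Vline R.
Proof.
apply: GL_line_eq => x y z w /mem_Vline[-> ->]; rewrite rot4_hvec.
exact/mem_Vline.
Qed.

Lemma translz_Zline c : GL_line (translz c) (Zline R) = Zline R.
Proof.
apply: GL_line_eq => x y z w /mem_Zline[-> ->]; rewrite translz_hvec.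
exact/mem_Zline.
Qed.

Lemma translz_Vline c : GL_line (translz c) (Vline R) = Vline R.
Proof.
apply: GL_line_eq => x y z w /mem_Vline[-> ->]; rewrite translz_hvec.
by apply/mem_Vline; split; ring.
Qed.

Lemma translz_ruling c r a b :
  GL_line (translz c) (ruling r a b) = ruling r a (b + c).
Proof.
apply: GL_line_eq => x y z w /mem_ruling[-> ->]; rewrite translz_hvec.
by apply/mem_ruling; split=> //; ring.
Qed.

(** The mirror image passes through [(- r, 0, b)]; turning it by [pi] brings this point back to
    [(r, 0, b)] and leaves slope [- a]. *)
Lemma refl_ruling r a b :
  GL_line refl (ruling r a b) = GL_line (rot4 pi) (ruling r (- a) b).
Proof.
apply: GL_line_eq => x y z w /mem_ruling[-> ->]; rewrite refl_hvec.
rewrite (_ : hvec _ _ _ _ = val (rot4 pi) *m hvec (r * w) (- y) (b * w + a * y) w).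
  by rewrite mem_GL_line_mul; apply/mem_ruling; split=> //; ring.
by rewrite rot4_hvec cospi sinpi; congr hvec; ring.
Qed.

Lemma refl_refl L : GL_line refl (GL_line refl L) = L.
Proof.
rewrite -GL_line_mul -[RHS]GL_line_one; apply: (congr1 (fun g => GL_line g L)).
apply: GL_hvec_ext => x y z w; rewrite GL_valM -mulmxA !refl_hvec opprK.
by rewrite [RHS]mul1mx.
Qed.

End SpecialCollineations.

(** * Constancy of the handedness along a compact spread *)

Section Orientation.
Variables (R : realType) (D : set (line R)).
Hypothesis Dcompact : compact D.
Hypothesis Dspread : spread D.
Hypothesis Drot : forall t L, D L -> D (GL_line (rot4 t) L).
Implicit Types (x y z w s t r a b e : R) (L M : line R).

(** The case of transitivity on lines that is needed: a spread line is [Zline], [Vline] or a rotated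
    ruling. *)
Lemma spread_qline L : D L -> exists g, L = qline g.
Proof.
move=> DL; have [->|LZ] := pselect (L = Zline R).
  by exists 1%g; rewrite /qline GL_line_one.
have [->|LV] := pselect (L = Vline R); first exact: Vline_qline.
have [t [r [a [b [[_ _ a0] ->]]]]] := rotated_ruling_in Dspread Drot DL LZ LV.
exact/GL_line_qline/ruling_qline.
Qed.

Lemma oriented_dichotomy L : D L -> L <> Zline R -> L <> Vline R ->
  oriented 1 L /\ ~ oriented (-1) L \/ oriented (-1) L /\ ~ oriented 1 L.
Proof.
move=> DL LZ LV.
have [t [r [a [b [[_ r0 a0] ->]]]]] := rotated_ruling_in Dspread Drot DL LZ LV.
have orE e := ruling_orientation e a b r0.
rewrite !oriented_rot !orE mul1r mulN1r opprK oppr_gt0.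
case/lt_total/orP: a0 => a0; [left|right]; split=> //.
  by apply/negP; rewrite -leNgt ltW.
by apply/negP; rewrite -leNgt ltW.
Qed.

Lemma axis_line_neq r L : 0 < r -> hvec r 0 0 1 \in val L ->
  L <> Zline R /\ L <> Vline R.
Proof.
move=> r0 rL; split=> E; move: rL; rewrite E.
  by move=> /mem_Zline[E0 _]; rewrite E0 ltxx in r0.
by move=> /mem_Vline[_ /eqP]; rewrite oner_eq0.
Qed.

(** Compactness, in near-covering form, reduces the claim to a neighbourhood of each spread line
    [M]. If [M] contains [(r, 0, 0)] it equals [L], and nearby lines keep its orientation; otherwise
    nearby lines miss all points close to [(r, 0, 0)]. *)
Lemma near_line_oriented e r L : 0 < r -> D L -> hvec r 0 0 1 \in val L ->
  oriented e L ->
  \forall r' \near r, forall M, D M -> hvec r' 0 0 1 \in val M -> oriented e M.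
Proof.
move=> r0 DL rL eL.
have := Dcompact; rewrite compact_near_coveringP => /(_ R (nbhs r)
  (fun r' M => hvec r' 0 0 1 \in val M -> oriented e M)) H.
apply: H => M DM; have [g gM] := spread_qline DM; rewrite gM.
apply: (@near_qline _ _ _ (fun r' M => hvec r' 0 0 1 \in val M -> oriented e M)).
have [rM|rM] := boolP (hvec r 0 0 1 \in val M).
  have ML : M = L.
    by apply: (meet_eq Dspread DM DL _ rM rL); apply: hvec_neq0; apply: Or44; rewrite oner_eq0.
  have := @near_oriented _ e g; rewrite -gM ML => /(_ eL) H.
  exists ([set g' | oriented e (qline g')], setT) => /=.
    by split=> //; exact: filterT.
  by move=> [g' r'] [].
rewrite gM in rM; apply: filterS (near_notin_qline rM) => -[g' r'] /= /negP rg' /rg'.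
by [].
Qed.

(** The ruling meets the plane [z = 0] in [(r, - (b / a), 0)]; a rotation carries this point to the
    positive x-axis and preserves the orientation. *)
Lemma ruling_meets_axis r a b : ruling_in D r a b ->
  exists2 r', 0 < r' & exists2 L, D L /\ hvec r' 0 0 1 \in val L &
    forall e, oriented e L <-> 0 < - (e * a).
Proof.
move=> [Dr r0 a0]; pose y := - (b / a).
have q0 : 0 < r ^+ 2 + y ^+ 2 by rewrite ltr_pwDl ?sqr_ge0 ?exprn_gt0.
pose r' := Num.sqrt (r ^+ 2 + y ^+ 2); exists r'; first by rewrite sqrtr_gt0.
have [|t [tr ty]] := @rotate_circle _ r y r' 0 q0.
  by rewrite sqr_sqrtr ?(ltW q0) // expr0n addr0.
exists (GL_line (rot4 t) (ruling r a b)); last first.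
  by move=> e; rewrite oriented_rot ruling_orientation.
split; first exact: Drot.
have -> : hvec r' 0 0 1 = val (rot4 t) *m hvec r y 0 1 by rewrite rot4_hvec -tr -ty.
rewrite mem_GL_line_mul; apply/mem_ruling.
by split; [ring|rewrite /y; field].
Qed.

(* The lines through the points [(r,0,0)] depend continuously on [r > 0] by
   compactness, so their orientation is constant. *)
Lemma ruling_sign r a b r' a' b' :
  ruling_in D r a b -> ruling_in D r' a' b' -> 0 < a -> 0 < a'.
Proof.
move=> ri ri' a_gt0; have [_ _ a'0] := ri'.
case/lt_total/orP: a'0 => // a'_lt0; exfalso.
pose P r := exists L, [/\ D L, hvec r 0 0 1 \in val L & oriented 1 L].
pose f r : R := if `[< P r >] then 1 else -1.
have fP x L : 0 < x -> D L -> hvec x 0 0 1 \in val L ->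
    forall e, oriented e L -> e = 1 \/ e = -1 -> f x = e.
  move=> x0 DL xL e eL e1.
  have [LZ LV] := axis_line_neq x0 xL.
  rewrite /f; case: asboolP => [[M [DM xM M1]]|nP]; case: e1 => e1; subst e => //.
    have ML : M = L.
      by apply: (meet_eq Dspread DM DL _ xM xL); apply: hvec_neq0; apply: Or44; rewrite oner_eq0.
    by rewrite ML in M1; case: (oriented_dichotomy DL LZ LV) => -[].
  by exfalso; apply: nP; exists L.
have linex x : exists2 L, D L & hvec x 0 0 1 \in val L.
  have [cov _] := (spreadP D).1 Dspread; apply: cov.
  by apply: hvec_neq0; apply: Or44; rewrite oner_eq0.
have orx x L : 0 < x -> D L -> hvec x 0 0 1 \in val L ->
    exists2 e, oriented e L & e = 1 \/ e = -1.
  move=> x0 DL xL; have [LZ LV] := axis_line_neq x0 xL.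
  by case: (oriented_dichotomy DL LZ LV) => -[? _]; [exists 1|exists (-1)]; auto.
have fc x : 0 < x -> {for x, continuous f}.
  move=> x0; have [L DL xL] := linex x; have [e eL e1] := orx x L x0 DL xL.
  have fx : f x = e by apply: fP eL e1.
  rewrite /prop_for /continuous_at fx; apply: cvg_near_cst.
  have := near_line_oriented x0 DL xL eL.
  have : \forall x' \near x, 0 < x' by exact: lt_nbhsr.
  apply: filterS2 => x' x'0 H; have [M DM xM] := linex x'.
  by apply: (fP _ M) => //; exact: H.
have [x x0 [L [DL xL] LE]] := ruling_meets_axis ri.
have [y y0 [M [DM yM] ME]] := ruling_meets_axis ri'.
have fx : f x = -1 by apply: (fP _ L) => //; [apply/LE; lra|right].
have fy : f y = 1 by apply: (fP _ M) => //; [apply/ME; lra|left].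
(* The intermediate value theorem would give a zero of [f], whose only values are 1 and -1. *)
have ivt u v : 0 < u -> u <= v -> Num.min (f u) (f v) <= 0 <= Num.max (f u) (f v) -> False.
  move=> u0 uv fuv; have [|z] := IVT uv _ fuv.
    apply: continuous_in_subspaceT => z; rewrite inE /= in_itv /= => /andP[uz _].
    exact: fc (lt_le_trans u0 uz).
  move=> _; rewrite /f; case: asboolP => _ /eqP; rewrite ?oppr_eq0 oner_eq0 //.
have n1 : -1 <= 1 :> R by lra.
have [xy|/ltW yx] := leP x y.
  by apply: (ivt x y) => //; rewrite fx fy (min_idPl n1) (max_idPr n1); lra.
by apply: (ivt y x) => //; rewrite fx fy (min_idPr n1) (max_idPl n1); lra.
Qed.

End Orientation.

(** * Invariance under the standard groups *)

Section Invariance.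
Variable R : realType.
Implicit Types (L M : line R) (C D : set (line R)) (p q : PGL R 4).

Lemma image_collineate_toPGL (g : GL R 4) D :
  collineate (toPGL g) @` D = GL_line g @` D.
Proof. by apply: eq_imagel => L _; exact: collineate_toPGL. Qed.

Lemma image_collineateM p q D :
  collineate (p * q)%g @` D = collineate p @` (collineate q @` D).
Proof. by rewrite image_comp; apply: eq_imagel => L _; exact: collineateM. Qed.

Lemma image_collineate1 D : collineate (1%g : PGL R 4) @` D = D.
Proof. by rewrite -[RHS]image_id; apply: eq_imagel => L _; exact: collineate1. Qed.

Lemma image_collineateK p D : collineate p^-1%g @` (collineate p @` D) = D.
Proof. by rewrite -image_collineateM mulVg image_collineate1. Qed.

Lemma compact_spread_collineate p C :
  compact_spread C -> compact_spread (collineate p @` C).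
Proof.
move=> [Cc Cs]; split; last exact: spread_collineate.
exact: (@compact_GL_line R (repr p) C Cc).
Qed.

Definition rot_closed D := forall t L, D L -> D (GL_line (rot4 t) L).

Definition halfturn_closed D :=
  forall L, D L -> D (GL_line (affine_ext (halfturn R)) L).

Lemma proj_ext1 : proj_ext 1%g = 1%g :> PGL R 4.
Proof. by apply: (@mulgI _ (proj_ext 1%g)); rewrite -proj_extM !mulg1. Qed.

Lemma stabilizer_subgroup D :
  subgroup [set A : GL R 3 | collineate (proj_ext A) @` D = D].
Proof.
split=> [|A B /= AD BD]; first by rewrite /= proj_ext1 image_collineate1.
have BV : collineate (proj_ext B^-1%g) @` D = D.
  by rewrite -{1}BD -image_collineateM -proj_extM mulVg proj_ext1 image_collineate1.
by rewrite proj_extM image_collineateM BV.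
Qed.

Lemma rot_closed_stable D : rot_closed D ->
  forall t, collineate (proj_ext (rotz t)) @` D = D.
Proof.
move=> Dr t; apply/seteqP; split=> L.
  by move=> [M DM <-]; rewrite collineate_rot; exact: Dr.
move=> DL; exists (GL_line (rot4 (- t)) L); first exact: Dr.
by rewrite collineate_rot -[X in rot4 X](opprK t) rot4K.
Qed.

Lemma halfturn_closed_stable D : halfturn_closed D ->
  collineate (proj_ext (halfturn R)) @` D = D.
Proof.
move=> Dh; apply/seteqP; split=> L.
  by move=> [M DM <-]; rewrite proj_extE; exact: Dh.
move=> DL; exists (GL_line (affine_ext (halfturn R)) L); first exact: Dh.
by rewrite proj_extE halfturn_halfturn.
Qed.

(** The stabilizer of [D] is a subgroup, so for [O2] it is enough to test the generators. *)
Lemma standard_group_stable Gamma D :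
  (forall A, standard_group R Gamma A -> collineate (proj_ext A) @` D = D) <->
  rot_closed D /\ (Gamma = O2 -> halfturn_closed D).
Proof.
split=> [DG|[Dr Dh]].
  have rotG t : standard_group R Gamma (rotz t).
    case: Gamma {DG}; last by exists t.
    by apply: sub_gen_smallest; left; exists t.
  split=> [t L DL|GO L DL].
    by rewrite -(DG _ (rotG t)); exists L; rewrite ?collineate_rot.
  rewrite -(DG (halfturn R)); first by exists L; rewrite ?proj_extE.
  by rewrite GO; apply: sub_gen_smallest; right.
move=> A; case: Gamma Dh => [/(_ erefl) Dh|_ [t _ <-]]; last exact: rot_closed_stable.
suff sub : standard_group R O2 `<=` [set A | collineate (proj_ext A) @` D = D].
  exact: sub.
apply: smallest_sub; first exact: stabilizer_subgroup.
move=> _ [[t _ <-]|->]; first exact: rot_closed_stable.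
exact: halfturn_closed_stable.
Qed.

Lemma rotational_form_rot_closed (a b : R -> R) : rot_closed (rotational_form a b).
Proof.
move=> t L [[->|->]|[r r0 [s _ <-]]].
- by left; left; rewrite rot4_Zline.
- by left; right; rewrite rot4_Vline.
right; exists r => //; exists (t + s) => //.
rewrite !collineate_rot -GL_line_mul; apply: (congr1 (fun g => GL_line g _)).
apply: GL_hvec_ext => x y z w; rewrite GL_valM -mulmxA !rot4_hvec cosD sinD.
by congr hvec; ring.
Qed.

(** The half-turn fixes each ruling with [b = 0] and inverts rotations, so it preserves every
    regulus. *)
Lemma rotational_form_halfturn_closed (a : R -> R) :
  halfturn_closed (rotational_form a (fun=> 0)).
Proof.
move=> L [[->|->]|[r r0 [t _ <-]]].
- by left; left; rewrite halfturn_Zline.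
- by left; right; rewrite halfturn_Vline.
right; exists r => //; exists (- t) => //.
rewrite !collineate_rot -GL_line_mul -[t in RHS]opprK -rot4_halfturn GL_line_mul.
by rewrite halfturn_ruling oppr0.
Qed.

Lemma translz_rotational_form (a b : R -> R) c : (forall r, 0 < r -> b r = c) ->
  GL_line (translz (- c)) @` rotational_form a b = rotational_form a (fun=> 0).
Proof.
move=> bc.
have rulE r t : 0 < r -> GL_line (translz (- c)) (GL_line (rot4 t) (ruling r (a r) (b r))) =
    GL_line (rot4 t) (ruling r (a r) 0).
  by move=> r0; rewrite -GL_line_mul -rot4_translz GL_line_mul translz_ruling bc ?subrr.
apply/seteqP; split=> L.
  move=> [_ [[->|->]|[r r0 [t _ <-]]] <-].
  - by left; left; rewrite translz_Zline.
  - by left; right; rewrite translz_Vline.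
  by right; exists r => //; exists t; rewrite // !collineate_rot rulE.
move=> [[->|->]|[r r0 [t _ <-]]].
- by exists (Zline R); [left; left|rewrite translz_Zline].
- by exists (Vline R); [left; right|rewrite translz_Vline].
exists (GL_line (rot4 t) (ruling r (a r) (b r))); last by rewrite rulE ?collineate_rot.
by right; exists r => //; exists t; rewrite ?collineate_rot.
Qed.

Lemma halfturn_waist D r a b : spread D -> halfturn_closed D ->
  ruling_in D r a b -> b = 0.
Proof.
move=> Ds Dh ri; have [Dr r0 a0] := ri.
have ri' : ruling_in D r a (- b) by split=> //; rewrite -halfturn_ruling; exact: Dh.
by have [_ bN] := waist_uniq Ds ri ri'; lra.
Qed.

Lemma rot_closed_refl D : rot_closed D -> rot_closed (GL_line (refl R) @` D).
Proof.
move=> Dr t _ [L DL <-]; rewrite -GL_line_mul rot4_refl GL_line_mul.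
by exists (GL_line (rot4 (- t)) L) => //; exact: Dr.
Qed.

Lemma halfturn_closed_refl D :
  halfturn_closed D -> halfturn_closed (GL_line (refl R) @` D).
Proof.
move=> Dh _ [L DL <-]; rewrite -GL_line_mul halfturn_refl GL_line_mul.
by exists (GL_line (affine_ext (halfturn R)) L) => //; exact: Dh.
Qed.

Lemma ruling_in_refl D r a b : rot_closed D ->
  ruling_in (GL_line (refl R) @` D) r a b -> ruling_in D r (- a) b.
Proof.
move=> Dr [[L DL LE] r0 a0]; split; rewrite ?oppr_eq0 //.
have : L = GL_line (rot4 pi) (ruling r (- a) b) by rewrite -refl_ruling -LE refl_refl.
by move=> E; rewrite -(rot4K pi (ruling r (- a) b)) -E; exact: Dr.
Qed.

(** By [ruling_sign] all slopes have one sign, so either [D] or its mirror image, called [D'] below,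
    has only positive ones; accordingly [g] is the identity or [refl]. *)
Lemma rotational_form_up_to_refl Gamma D : compact_spread D -> rot_closed D ->
  (Gamma = O2 -> halfturn_closed D) ->
  exists (g : GL R 4) (a b : R -> R),
    [/\ forall r, 0 < r -> 0 < a r,
        Gamma = O2 -> exists c, forall r, 0 < r -> b r = c &
        GL_line g @` D = rotational_form a b].
Proof.
suff pos D' (g : GL R 4) : D' = GL_line g @` D -> compact_spread D' -> rot_closed D' ->
    (Gamma = O2 -> halfturn_closed D') ->
    (forall r a b, ruling_in D' r a b -> 0 < a) ->
    exists (g : GL R 4) (a b : R -> R),
      [/\ forall r, 0 < r -> 0 < a r,
          Gamma = O2 -> exists c, forall r, 0 < r -> b r = c &
          GL_line g @` D = rotational_form a b].
  move=> Dcs Dr Dh; have [Dc Ds] := Dcs.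
  have [apos|] := pselect (forall r a b, ruling_in D r a b -> 0 < a).
    apply: (pos D 1%g) => //.
    by rewrite -[LHS]image_id; apply: eq_imagel => L _; rewrite GL_line_one.
  move=> /existsNP[r /existsNP[a /existsNP[b /not_implyP[ri /negP]]]].
  rewrite -leNgt => a_le0.
  apply: (pos (GL_line (refl R) @` D) (refl R)) => //.
  - by rewrite -image_collineate_toPGL; exact: compact_spread_collineate.
  - exact: rot_closed_refl.
  - by move=> /Dh; exact: halfturn_closed_refl.
  (* A negative [a'] in the mirror image comes from the positive slope [- a'] in [D], and
     [ruling_sign] would then make [a] positive. *)
  move=> r' a' b' /(ruling_in_refl Dr) ri'; have [_ _ a'0] := ri'.
  rewrite oppr_eq0 in a'0; case/lt_total/orP: a'0 => // a'_lt0.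
  have Na'_gt0 : 0 < - a' by rewrite oppr_gt0.
  by have := ruling_sign Dc Ds Dr ri' ri Na'_gt0; rewrite ltNge a_le0.
move=> DE [Dc Ds] Dr Dh apos.
have [a [b [a0 Dab D'E]]] := rotational_formP Ds Dr apos.
exists g, a, b; split=> //; last by rewrite -DE.
move=> /Dh D'h; exists 0 => r r0; apply: (halfturn_waist Ds D'h (r := r) (a := a r)).
by split; [exact: Dab|exact: r0|rewrite gt_eqF // a0].
Qed.

End Invariance.

(** * The characterization by group actions *)

Theorem theorem4p2 (R : realType) (Gamma : rotation_group) (C : set (line R)) :
  compact_spread C ->
  (rotational Gamma C <->
  exists phi : GL R 3 -> PGL R 4,
    [/\ action_by_collineations (standard_group R Gamma) phi,
        equivalent_actions (standard_group R Gamma) phi (@proj_ext R) &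
        action_invariant (standard_group R Gamma) phi C]).
Proof.
move=> Cs; split.
  move=> [a [b [a0 bO cs [p pC]]]].
  (* For [SO2] the given isomorphism [p] serves as [q]; for [O2] it is followed by the translation
     that moves the constant [b] to 0. The action sought is the standard one conjugated by [q]. *)
  have [q qC] : exists q : PGL R 4, forall A, standard_group R Gamma A ->
      collineate (proj_ext A) @` (collineate q @` C) = collineate q @` C.
    case: Gamma bO => [/(_ erefl)[c bc]|_].
      exists (toPGL (translz (- c)) * p)%g.
      rewrite image_collineateM pC image_collineate_toPGL (translz_rotational_form a bc).
      apply/standard_group_stable; split=> [|_]; first exact: rotational_form_rot_closed.
      exact: rotational_form_halfturn_closed.
    exists p; rewrite pC; apply/standard_group_stable.
    by split=> //; exact: rotational_form_rot_closed.
  exists (fun A => q^-1 * proj_ext A * q)%g; split.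
  - by move=> A B _ _; rewrite proj_extM -!mulgA mulVKg.
  - by exists q^-1%g => A _; rewrite invgK.
  - by move=> A GA; rewrite !image_collineateM qC // image_collineateK.
move=> [phi [_ [p phiE] phiC]].
(* Undoing the conjugation makes the standard action itself preserve the spread. *)
pose D := collineate p^-1%g @` C.
have Dcs : compact_spread D by exact: compact_spread_collineate.
have [Dr Dh] : rot_closed D /\ (Gamma = O2 -> halfturn_closed D).
  apply/standard_group_stable => A GA.
  by rewrite /D -[in RHS](phiC A GA) phiE // -!image_collineateM !mulgA mulVg mul1g.
have [g [a [b [a0 bO DE]]]] := rotational_form_up_to_refl Dcs Dr Dh.
exists a, b; split=> //.
  by rewrite -DE -image_collineate_toPGL; exact: compact_spread_collineate.
by exists (toPGL g * p^-1)%g; rewrite image_collineateM image_collineate_toPGL.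
Qed.
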